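(* Let $A$ be a complex, semisimple Banach algebra with identity element $\mathbf 1$, let $a \in \operatorname{soc}(A)$, and let $$p_a(\lambda)=\prod_{\alpha \in \sigma_A(a)} (\alpha-\lambda)^{m(\alpha,a)}$$ be its generalized characteristic polynomial, where $m(\alpha,a)$ is the spectral multiplicity of $a$ at $\alpha$. Then $p_a(a)=0$, that is, $$\prod_{\alpha \in \sigma_A(a)} (\alpha\mathbf 1-a)^{m(\alpha,a)}=0 .$$
   Context: For $x\in A$, $\sigma_A(x)=\{\lambda\in\mathbb C:\lambda\mathbf 1-x \text{ is not invertible in } A\}$ and $\sigma_A'(x)=\sigma_A(x)\setminus\{0\}$. The symbol $\#K$ denotes the number of distinct elements of a set $K\subseteq\mathbb C$. The rank of $a\in A$ is $\operatorname{rank}_A(a)=\sup_{x\in A}\#\sigma_A'(xa)\le\infty$. The socle $\operatorname{soc}(A)$ of the semisimple Banach algebra $A$ coincides with the set of finite-rank elements $\{a\in A:\operatorname{rank}_A(a)<\infty\}$ (a known result of Aupetit and Mouton); elements of the socle have finite spectrum. For $a\in\operatorname{soc}(A)$ let $E_A(a)=\{x\in A:\#\sigma_A'(xa)=\operatorname{rank}_A(a)\}$, which is known to be open and dense in $A$. Spectral multiplicity: let $a\in\operatorname{soc}(A)$, $\lambda\in\sigma_A(a)$, and let $V_\lambda$ be an open disk centered at $\lambda$ containing no other points of $\sigma_A(a)$. It is known that there is an open ball $U\subset A$ centered at $\mathbf 1$ such that $\#[\sigma_A(xa)\cap V_\lambda]$ is constant as $x$ runs through $E_A(a)\cap U$.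 This constant integer is the multiplicity $m(\lambda,a)$ of $a$ at $\lambda$. (It is also defined when $\lambda = 0\in\sigma_A(a)$.) *)

(* Defs.v *)
From HB Require Import structures.
From mathcomp Require Import all_boot all_order all_algebra.
From mathcomp Require Import finmap complex.
From mathcomp Require Import all_classical all_reals all_analysis.

Set Implicit Arguments.
Unset Strict Implicit.
Unset Printing Implicit Defensive.

Import Order.TTheory GRing.Theory Num.Theory.
Import numFieldNormedType.Exports.

Local Open Scope classical_set_scope.
Local Open Scope ring_scope.

(* The library has no structure joining normed modules and algebras, and one
   cannot be added downstream: numDomainType already inherits from both the ring
   and the norm hierarchies, hence their join would have to be declared before
   it.  A Banach algebra is therefore a record extending a complete normed module
   with a product, and its carrier is declared below as an instance of both
   completeNormedModType K and algType K, over the same K-module.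
   Only submultiplicativity is required of the norm: `|1| = 1 is not assumed
   (it can always be arranged by passing to an equivalent norm). *)
Record banachAlgebra (K : numFieldType) := BanachAlgebra {
  banach_space : completeNormedModType K;
  ba_one : banach_space;
  ba_mul : banach_space -> banach_space -> banach_space;
  ba_mulA : associative ba_mul;
  ba_mul1l : left_id ba_one ba_mul;
  ba_mul1r : right_id ba_one ba_mul;
  ba_mulDl : left_distributive ba_mul +%R;
  ba_mulDr : right_distributive ba_mul +%R;
  ba_one_neq0 : ba_one != 0;
  ba_scaleAl : forall (k : K) x y, k *: ba_mul x y = ba_mul (k *: x) y;
  ba_scaleAr : forall (k : K) x y, k *: ba_mul x y = ba_mul x (k *: y);
  ba_norm_mul : forall x y, `|ba_mul x y| <= `|x| * `|y|
}.

Definition ba_carrier (K : numFieldType) (B : banachAlgebra K) : Type :=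
  banach_space B.
Coercion ba_carrier : banachAlgebra >-> Sortclass.

Section BanachAlgebraInstances.
Variables (K : numFieldType) (B : banachAlgebra K).

HB.instance Definition _ :=
  CompleteNormedModule.copy (ba_carrier B) (banach_space B).
HB.instance Definition _ := GRing.Zmodule_isNzRing.Build (ba_carrier B)
  (@ba_mulA K B) (@ba_mul1l K B) (@ba_mul1r K B) (@ba_mulDl K B) (@ba_mulDr K B)
  (@ba_one_neq0 K B).
HB.instance Definition _ := GRing.Lmodule_isLalgebra.Build K (ba_carrier B)
  (@ba_scaleAl K B).
HB.instance Definition _ := GRing.Lalgebra_isAlgebra.Build K (ba_carrier B)
  (@ba_scaleAr K B).

Lemma ba_ler_normM (x y : B) : `|x * y| <= `|x| * `|y|.
Proof. exact: ba_norm_mul. Qed.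

End BanachAlgebraInstances.

Section Ideals.
Variable A : nzRingType.
Implicit Types L : set A.

Definition left_ideal L : Prop :=
  [/\ L 0,
      forall x y, L x -> L y -> L (x + y)
    & forall x y, L y -> L (x * y)].

Definition maximal_left_ideal L : Prop :=
  [/\ left_ideal L,
      L <> setT
    & forall M, left_ideal M -> L `<=` M -> M <> setT -> M = L].

Definition minimal_left_ideal L : Prop :=
  [/\ left_ideal L,
      L <> [set 0]
    & forall M, left_ideal M -> M `<=` L -> M <> [set 0] -> M = L].

Definition jacobson_radical : set A :=
  [set x | forall L, maximal_left_ideal L -> L x].

Definition semisimple : Prop := jacobson_radical = [set 0].

(* The algebraic sum of all minimal left ideals; it is {0} when there are
   none (take n = 0). *)
Definition socle : set A :=
  [set a | exists (n : nat) (f : 'I_n -> A),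
     (forall i, exists2 L, minimal_left_ideal L & L (f i)) /\
     a = \sum_(i < n) f i].

Definition invertible (x : A) : Prop := exists y, x * y = 1 /\ y * x = 1.

End Ideals.
Arguments semisimple A : clear implicits.
Arguments socle A : clear implicits.

Section Spectral.
Variables (R : realType) (A : banachAlgebra R[i]).
Implicit Types (a x : A) (z : R[i]).

Definition spectrum x : set R[i] := [set z | ~ invertible (z%:A - x)].

Definition nz_spectrum x : set R[i] := spectrum x `\ 0.

(* #K as an extended real, +oo when K is infinite *)
Definition nb_points (K : set R[i]) : \bar R := counting K.

Definition rank a : \bar R :=
  ereal_sup [set nb_points (nz_spectrum (x * a)) | x in [set: A]].

Definition rank_attaining a : set A :=
  [set x | nb_points (nz_spectrum (x * a)) = rank a].

Definition open_disk z (r : R[i]) : set R[i] := [set w | `|w - z| < r].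

(* The positive radii r and d live in R[i], in which norms take their values;
   0 < r forces r to be real. *)
Definition is_multiplicity a z (k : nat) : Prop :=
  exists2 r : R[i],
    0 < r /\ spectrum a `&` open_disk z r = [set z] &
    exists2 d : R[i], 0 < d &
      forall x, rank_attaining a x -> ball (1 : A) d x ->
        nb_points (spectrum (x * a) `&` open_disk z r) = k%:R%:E.

(* For a in the socle and z in its spectrum there is exactly one k satisfying
   is_multiplicity a z k; the default value 0 only serves to make the function
   total. *)
Definition multiplicity a z : nat := xget 0%N [set k | is_multiplicity a z k].

(* The spectrum is turned into the finite set indexing the product by fset_set,
   which is meaningful for finite spectra, hence for a in the socle. *)
Definition gen_char_poly a : {poly R[i]} :=
  \prod_(z <- fset_set (spectrum a)) (z%:P - 'X) ^+ multiplicity a z.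

End Spectral.

(* Main.v *)
Require Import Defs.
From mathcomp Require Import all_boot all_order all_algebra perm separable.
From mathcomp Require Import finmap complex ring lra.
From mathcomp Require Import all_classical all_reals all_analysis.
Import Order.TTheory GRing.Theory Num.Theory.
Import numFieldNormedType.Exports.
Set Implicit Arguments.
Unset Strict Implicit.
Unset Printing Implicit Defensive.
Local Open Scope classical_set_scope.
Local Open Scope ring_scope.

(** A semisimple algebra is semiprime ([semisimple_semiprime]), so every minimal
    left ideal is generated by an idempotent [e] whose corner [e A e] is a
    division algebra, and this corner reduces to the scalar multiples of [e]
    ([gelfand_mazur_corner]).  Choosing one idempotent in each class of linked
    ones, an element [a] of the socle becomes [\sum_(i < n) g i * s i], where each
    [g i] lies in [A * eps i] and each [s i] in [eps i * A] ([socle_factorable]).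
    Then [s j * x * g k] is a scalar multiple [M x j k] of [eps j], the matrix
    [M x] depends linearly and continuously on [x], and for [z != 0] the element
    [z - x * a] is invertible exactly when [z - M x] is ([fac_spectrum]).  By the
    Cayley-Hamilton theorem for [M x], the characteristic polynomial of [M x]
    evaluated at [x * a] is annihilated by [x * a] ([fac_char_poly]).

    Take [n] minimal.  The [g i] and the [s i] then admit dual systems, so that
    some [M x] is diagonal with distinct nonzero entries
    ([minimal_factorization_diag]).  It follows that [n] is the rank of [a], and
    that [x] attains the rank exactly when [M x] has [n] distinct nonzero
    eigenvalues ([rank_attainingP]).  A resultant shows that such [x] exist
    arbitrarily close to [1] ([rank_attaining_dense]).  By continuity of the roots
    of a polynomial ([roots_continuous]), for these [x] the number of points of
    the spectrum of [x * a] near [z] is the multiplicity of [z] as a root of the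
    characteristic polynomial of [M 1], with one more for [z = 0], which remains
    in the spectrum ([spectrum_count_near]).  Hence the spectral multiplicity of
    [z] is its multiplicity as a root of ['X * char_poly (M 1)], and this
    polynomial annihilates [a] by Cayley-Hamilton. *)

(** * Semiprimeness and minimal left ideals *)

Section SemisimpleRings.
Variable A : nzRingType.
Implicit Types (L : set A) (u v w e f x y z : A).

Lemma left_idealB L x y : left_ideal L -> L x -> L y -> L (x - y).
Proof.
by move=> [_ LD LM] Lx Ly; apply: LD => //; rewrite -mulN1r; apply: LM.
Qed.

Lemma left_ideal_principal u : left_ideal [set x * u | x in [set: A]].
Proof.
split; first by exists 0; rewrite ?mul0r.
- by move=> _ _ [x _ <-] [y _ <-]; exists (x + y); rewrite ?mulrDl.
- by move=> x _ [y _ <-]; exists (x * y); rewrite ?mulrA.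
Qed.

Lemma left_ideal_mulr L u : left_ideal L -> left_ideal [set z * u | z in L].
Proof.
move=> [L0 LD LM]; split; first by exists 0; rewrite ?mul0r.
- by move=> _ _ [x Lx <-] [y Ly <-]; exists (x + y); rewrite ?mulrDl //; exact: LD.
- by move=> x _ [y Ly <-]; exists (x * y); rewrite ?mulrA //; exact: LM.
Qed.

Lemma left_ideal_ker L u : left_ideal L -> left_ideal [set z | L z /\ z * u = 0].
Proof.
move=> [L0 LD LM]; split => [|x y [Lx x0] [Ly y0]|x y [Ly y0]] /=.
- by rewrite mul0r.
- by split; [exact: LD | rewrite mulrDl x0 y0 addr0].
- by split; [exact: LM | rewrite -mulrA y0 mulr0].
Qed.

Definition semiprime := forall u, (forall x, u * x * u = 0) -> u = 0.

(** If [u A u = 0] then [u] lies in every maximal left ideal [L]: otherwise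
    [L + A u] is the whole algebra, and some [1 - x * u] belongs to [L] although
    it is invertible, [x * u] being nilpotent. *)
Lemma semisimple_semiprime : semisimple A -> semiprime.
Proof.
move=> ssA u uAu; suff: jacobson_radical u by rewrite ssA.
move=> L [Lid LT Lmax]; have [L0 LD LM] := Lid.
pose M := [set l + x * u | l in L & x in [set: A]].
have Mid : left_ideal M.
  split; first by exists 0 => //; exists 0 => //; rewrite mul0r addr0.
  - move=> _ _ [l Ll [x _ <-]] [m Lm [y _ <-]].
    by exists (l + m); [exact: LD | exists (x + y); rewrite // mulrDl addrACA].
  - move=> z _ [l Ll [x _ <-]].
    by exists (z * l); [exact: LM | exists (z * x); rewrite // mulrDr mulrA].
have LsubM : L `<=` M by move=> l Ll; exists l => //; exists 0; rewrite // mul0r addr0.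
have [MT|MnT] := pselect (M = setT); last first.
  rewrite -(Lmax M Mid LsubM MnT).
  by exists 0 => //; exists 1; rewrite // mul1r add0r.
have : M 1 by rewrite MT.
move=> [l Ll [x _ e1]]; exfalso; apply: LT.
(* [x * u] squares to zero, so [l = 1 - x * u] has the left inverse
   [1 + x * u] *)
have L1 : L 1.
  have <- : (1 + x * u) * l = 1; last exact: LM.
  have -> : l = 1 - x * u by rewrite -e1 addrK.
  rewrite mulrDl mul1r mulrBr mulr1.
  have -> : x * u * (x * u) = 0 by rewrite -!mulrA (mulrA u) uAu mulr0.
  by rewrite subr0 subrK.
by apply/seteqP; split=> // y _; rewrite -(mulr1 y); exact: LM.
Qed.

(** Brauer's lemma.  Right multiplication by a suitable [u] of [L] is a bijection
    of [L] by minimality, and the solution [e] of [e * u = u] is the required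
    idempotent; the division property comes from the minimality of [L] as well,
    since any nonzero [e * x * e] generates [L]. *)
Lemma minimal_left_ideal_idempotent L :
    semiprime -> minimal_left_ideal L ->
  exists e, [/\ e * e = e, e != 0, forall f, L f -> f * e = f &
    forall x, e * x * e != 0 -> exists2 z, e * z * e = z & z * (e * x * e) = e].
Proof.
move=> spA [Lid L0 Lmin]; have [Lz LD LM] := Lid.
have [f Lf f0] : exists2 f, L f & f <> 0.
  apply: contrapT => /forall2NP noL; apply: L0; apply/seteqP; split=> [x Lx|_ ->//].
  by have [|/contrapT] := noL x.
have [t ftf] : exists t, f * t * f != 0.
  apply: contrapT => /forallNP fAf; apply: f0; apply: spA => x.
  by apply/eqP; apply: contrapT => /negP; exact: fAf.
pose u := t * f.
have Lu : [set z * u | z in L] = L.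
  apply: Lmin; first exact: left_ideal_mulr.
  - by move=> _ [z Lz' <-]; rewrite /u mulrA; apply: LM.
  - move=> E; have : [set z * u | z in L] (f * u) by exists f.
    by rewrite E /u mulrA /= => /eqP; rewrite (negPf ftf).
have ker z : L z -> z * u = 0 -> z = 0.
  move=> Lz' zu; apply: contrapT => z0.
  have E : [set z | L z /\ z * u = 0] = L.
    apply: Lmin; [exact: left_ideal_ker|by move=> ? []|].
    by move=> E; have : [set z | L z /\ z * u = 0] z by []; rewrite E.
  have : L f by []. rewrite -E => -[_ fu].
  by move: ftf; rewrite -mulrA fu eqxx.
have [e Le eu] : [set z * u | z in L] u by rewrite Lu; apply: LM.
have re z : L z -> z * e = z.
  move=> Lz'; apply/eqP; rewrite -subr_eq0; apply/eqP/ker.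
    by apply: left_idealB => //; apply: LM.
  by rewrite mulrBl -mulrA eu subrr.
have e0 : e != 0.
  by apply/eqP => e0; move: ftf; rewrite -mulrA -/u -eu e0 mul0r mulr0 eqxx.
exists e; split=> //; first exact: re.
move=> x w0; set w := e * x * e in w0 *.
have Lw : L w by apply: LM.
have E : [set z * w | z in [set: A]] = L.
  apply: Lmin; first exact: left_ideal_principal.
  - by move=> _ [z _ <-]; apply: LM.
  - move=> E; have : [set z * w | z in [set: A]] w by exists 1; rewrite ?mul1r.
    by rewrite E => /eqP; rewrite (negPf w0).
have [z _ zw] : [set z * w | z in [set: A]] e by rewrite E.
have ew : e * w = w by rewrite /w !mulrA (re e).
exists (e * z * e).
  by rewrite !mulrA (re e) // -!mulrA (re e).
by rewrite -mulrA ew -mulrA zw re.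
Qed.

End SemisimpleRings.

(** * Rank-one idempotents and factorizations *)

Section RankOneIdempotents.
Variables (K : fieldType) (A : algType K).
Hypothesis spA : semiprime A.
Implicit Types (e f g x y z u : A) (c : K).

Definition rank1_idem e :=
  [/\ e * e = e, e != 0 & forall x, exists c, e * x * e = c *: e].

(** For rank-one idempotents, this says that the simple modules [A e] and [A f]
    are isomorphic. *)
Definition linked e f := exists x, e * x * f != 0.

Lemma semiprime_neq0 u : u != 0 -> exists x, u * x * u != 0.
Proof.
move=> /eqP u0; apply: contrapT => /forallNP uAu; apply: u0; apply: spA => x.
by apply/eqP; apply: contrapT => /negP; exact: uAu.
Qed.

Lemma linked_factor e f : rank1_idem e -> linked e f ->
  exists p q, e * p * f * q * e = e.
Proof.
move=> [ee e0 eAe] [x u0]; have [y uyu] := semiprime_neq0 u0.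
have [c Ec] := eAe (x * f * y).
have c0 : c != 0.
  apply: contraNneq uyu => c0; move: Ec; rewrite c0 scale0r => Ec.
  by rewrite !mulrA in Ec *; rewrite Ec !mul0r.
exists (c^-1 *: x), y; rewrite -scalerAr -!scalerAl -!mulrA.
by rewrite !mulrA in Ec *; rewrite Ec scalerA mulVf // scale1r.
Qed.

Lemma linked_sym e f : linked e f -> linked f e.
Proof.
move=> [x u0]; have [y uyu] := semiprime_neq0 u0.
exists y; apply: contraNneq uyu => fye.
have -> : e * x * f * y * (e * x * f) = e * x * (f * y * e) * (x * f).
  by rewrite !mulrA.
by rewrite fye mulr0 mul0r.
Qed.

Lemma linked_trans e f g : rank1_idem f -> linked e f -> linked f g -> linked e g.
Proof.
move=> rf /linked_sym ef [y u0]; have [p [q fpq]] := linked_factor rf ef.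
exists (q * f * y); apply: contraNneq u0 => eg.
have -> : f * y * g = f * p * (e * (q * f * y) * g) by rewrite -{1}fpq !mulrA.
by rewrite eg mulr0.
Qed.

(** One idempotent per linkage class, chosen as a function of the class alone,
    so that two linked idempotents receive the same representative. *)
Definition class_repr e : A := xget 0 [set f | rank1_idem f /\ linked e f].

Lemma class_reprP e : rank1_idem e ->
  rank1_idem (class_repr e) /\ linked e (class_repr e).
Proof.
move=> re; have [ee e0 _] := re.
rewrite /class_repr; case: xgetP => [f ->//|/(_ e)]; case; split=> //.
by exists 1; rewrite mulr1 ee.
Qed.

Lemma class_repr_eq e f : rank1_idem e -> rank1_idem f -> linked e f ->
  class_repr e = class_repr f.
Proof.
move=> re rf ef; rewrite /class_repr; congr xget; apply/seteqP.
split=> g /= [rg lg]; split=> //; last exact: linked_trans lg.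
by apply: linked_trans lg => //; exact: linked_sym.
Qed.

Lemma class_repr_unlinked e f x : rank1_idem e -> rank1_idem f ->
  class_repr e != class_repr f -> class_repr e * x * class_repr f = 0.
Proof.
move=> re rf; apply: contraNeq => ex.
have [re' le] := class_reprP re; have [rf' lf] := class_reprP rf.
apply/eqP/class_repr_eq => //.
apply: linked_trans le _ => //; apply: linked_trans (linked_sym lf) => //.
by exists x.
Qed.

(** The idempotents are pairwise equal or unlinked.  This normalization makes
    each [s j * x * g k] a scalar multiple of [eps j] and of [eps k] at once, and
    so turns [x] into a matrix over [K]. *)
Definition factorization (a : A) n (g s eps : 'I_n -> A) :=
  [/\ forall i, rank1_idem (eps i),
      forall i j, eps i != eps j -> forall x, eps i * x * eps j = 0,
      forall i, g i * eps i = g i,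
      forall i, eps i * s i = s i
    & \sum_i g i * s i = a].

(** Each [f i] is carried from its own idempotent [e i] to the representative of
    the class of [e i], through [e * p * eps * q * e = e]. *)
Lemma factorization_sum n (f e : 'I_n -> A) :
    (forall i, rank1_idem (e i)) -> (forall i, f i * e i = f i) ->
  exists (g s eps : 'I_n -> A), factorization (\sum_i f i) g s eps.
Proof.
move=> re fe; pose eps i := class_repr (e i).
have /choice [p Hp] i : exists pq, e i * pq.1 * eps i * pq.2 * e i = e i.
  have [_ l] := class_reprP (re i); have [p [q H]] := linked_factor (re i) l.
  by exists (p, q).
have re' i : rank1_idem (eps i) by have [] := class_reprP (re i).
have epsK i : eps i * eps i = eps i by have [] := re' i.
exists (fun i => f i * (p i).1 * eps i), (fun i => eps i * (p i).2 * e i), eps.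
split => //.
- by move=> i j ij x; apply: class_repr_unlinked.
- by move=> i; rewrite -!mulrA epsK.
- by move=> i; rewrite !mulrA epsK.
- apply: eq_bigr => i _; rewrite -{2}fe -{2}Hp !mulrA fe.
  by rewrite -(mulrA _ (eps i) (eps i)) epsK.
Qed.

Definition scalar_coef e u : K := xget 0 [set c | u = c *: e].

Lemma scalar_coefE e c : e != 0 -> scalar_coef e (c *: e) = c.
Proof.
move=> e0; rewrite /scalar_coef; case: xgetP => [d _ /= /eqP|/(_ c)[]//].
by rewrite -subr_eq0 -scalerBl scaler_eq0 (negPf e0) orbF subr_eq0 => /eqP ->.
Qed.

End RankOneIdempotents.

(** * The matrix of a factorization *)

Lemma horner_char_poly (R : comNzRingType) n (M : 'M[R]_n) (z : R) :
  (char_poly M).[z] = \det (z%:M - M).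
Proof.
rewrite -[LHS]/(horner_eval z _) -det_map_mx; congr (\det _).
by apply/matrixP => i j; rewrite !mxE /= /horner_eval !hornerE; case: eqP;
  rewrite ?hornerE.
Qed.

Section FactorizationMatrix.
Variables (K : fieldType) (A : algType K) (n : nat).
Variables (a : A) (g s eps : 'I_n -> A).
Hypothesis fac : factorization a g s eps.
Implicit Types (x y : A) (z : K) (N : 'M[K]_n).

Definition fac_mx x : 'M[K]_n :=
  \matrix_(j, k) scalar_coef (eps j) (s j * x * g k).

Let eps_neq0 i : eps i != 0. Proof. by case: fac => /(_ i)[]. Qed.
Let g_eps i : g i * eps i = g i. Proof. by case: fac. Qed.
Let eps_s i : eps i * s i = s i. Proof. by case: fac. Qed.
Let sum_gs : \sum_i g i * s i = a. Proof. by case: fac. Qed.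

Lemma fac_mxEl x j k : s j * x * g k = fac_mx x j k *: eps j.
Proof.
have [c E] : exists c, s j * x * g k = c *: eps j.
  have -> : s j * x * g k = eps j * (s j * x * g k) * eps k.
    by rewrite !mulrA eps_s -!mulrA g_eps.
  case: fac => r1 disj _ _ _; have [ejk|ejk] := eqVneq (eps j) (eps k).
    by rewrite -ejk; case: (r1 j).
  by exists 0; rewrite disj // scale0r.
by rewrite mxE E scalar_coefE.
Qed.

Lemma fac_mxEr x j k : s j * x * g k = fac_mx x j k *: eps k.
Proof.
have [<-|ejk] := eqVneq (eps j) (eps k); first exact: fac_mxEl.
have E : s j * x * g k = 0.
  have -> : s j * x * g k = eps j * (s j * x * g k) * eps k.
    by rewrite !mulrA eps_s -!mulrA g_eps.
  by case: fac => _ disj _ _ _; rewrite disj.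
by have /eqP := fac_mxEl x j k; rewrite E eq_sym scaler_eq0 (negPf (eps_neq0 j))
  orbF => /eqP ->; rewrite scale0r.
Qed.

Lemma fac_mx_unique x N :
  (forall j k, s j * x * g k = N j k *: eps j) -> fac_mx x = N.
Proof. by move=> E; apply/matrixP => j k; rewrite mxE E scalar_coefE. Qed.

Lemma fac_mx_lin x y z : fac_mx (x + z *: y) = fac_mx x + z *: fac_mx y.
Proof.
apply: fac_mx_unique => j k; rewrite mulrDr mulrDl -scalerAr -scalerAl.
rewrite !fac_mxEl scalerA -scalerDl; congr (_ *: _).
by move: (fac_mx x) (fac_mx y) => M N; rewrite !mxE.
Qed.

(** This map intertwines multiplication by [x * a] with multiplication by
    [fac_mx x], on either side, and it sends the identity matrix to [x * a].
    Inverses and polynomial identities pass through it from matrices to [A]. *)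
Definition border x N : A := \sum_j \sum_k N j k *: (x * g j * s k).

Lemma border_lin x z (N N' : 'M[K]_n) :
  border x (N + z *: N') = border x N + z *: border x N'.
Proof.
rewrite /border scaler_sumr -big_split; apply: eq_bigr => j _ /=.
rewrite scaler_sumr -big_split; apply: eq_bigr => k _ /=.
by rewrite !mxE scalerDl scalerA.
Qed.

Lemma border0 x : border x 0 = 0.
Proof.
by rewrite /border big1 // => j _; rewrite big1 // => k _; rewrite mxE scale0r.
Qed.

Lemma borderB x z (N N' : 'M[K]_n) :
  border x (z *: N - N') = z *: border x N - border x N'.
Proof.
have E (N1 : 'M[K]_n) : border x (z *: N1) = z *: border x N1.
  by rewrite -[z *: N1]add0r border_lin border0 add0r.
by rewrite -(scaleN1r N') border_lin E scaleN1r.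
Qed.

Lemma border1 x : border x 1%:M = x * a.
Proof.
rewrite -sum_gs mulr_sumr; apply: eq_bigr => j _.
rewrite (bigD1 j) //= mxE eqxx scale1r big1 ?addr0 ?mulrA // => k kj.
by rewrite mxE eq_sym (negPf kj) scale0r.
Qed.

Lemma border_mull x N : x * a * border x N = border x (fac_mx x *m N).
Proof.
rewrite -sum_gs mulr_sumr mulr_suml; apply: eq_bigr => i _.
rewrite [RHS](eq_bigr (fun k => \sum_j fac_mx x i j * N j k *: (x * g i * s k)));
  last by move=> k _; rewrite mxE scaler_suml.
rewrite exchange_big mulr_sumr; apply: eq_bigr => j _ /=.
rewrite mulr_sumr; apply: eq_bigr => k _.
rewrite -scalerAr (mulrC (fac_mx x i j)) -scalerA; congr (_ *: _).
have -> : x * (g i * s i) * (x * g j * s k) = x * g i * (s i * x * g j) * s k.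
  by rewrite !mulrA.
by rewrite fac_mxEl -scalerAr -scalerAl -(mulrA x (g i) (eps i)) g_eps.
Qed.

Lemma border_mulr x N : border x N * (x * a) = border x (N *m fac_mx x).
Proof.
rewrite /border mulr_suml; apply: eq_bigr => j _.
rewrite [RHS](eq_bigr (fun k => \sum_i N j i * fac_mx x i k *: (x * g j * s k)));
  last by move=> k _; rewrite mxE scaler_suml.
rewrite exchange_big mulr_suml; apply: eq_bigr => i _ /=.
rewrite -scalerAl -sum_gs !mulr_sumr scaler_sumr; apply: eq_bigr => k _.
rewrite -scalerA; congr (_ *: _).
have -> : x * g j * s i * (x * (g k * s k)) = x * g j * (s i * x * g k) * s k.
  by rewrite !mulrA.
by rewrite fac_mxEr -scalerAr -scalerAl -(mulrA (x * g j)) eps_s.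
Qed.

(** An eigenvector [v] of the matrix yields the eigenvector
    [\sum_k v k *: (x * g k)] of left multiplication by [x * a]; conversely the
    inverse of [z - fac_mx x] yields that of [z - x * a]. *)
Lemma fac_spectrum x z : z != 0 ->
  invertible (z%:A - x * a) <-> ~~ root (char_poly (fac_mx x)) z.
Proof.
move=> z0; set M := fac_mx x.
rewrite /root horner_char_poly -/M; split=> [[y [_ yl]]|dM].
  rewrite -det_tr; apply/det0P => -[v v0].
  rewrite linearB /= tr_scalar_mx mulmxBr mul_mx_scalar => /subr0_eq/esym vM.
  pose w := \sum_k v 0 k *: (x * g k).
  have s_w j : s j * w = (z * v 0 j) *: eps j.
    rewrite mulr_sumr (eq_bigr (fun k => (v 0 k * M j k) *: eps j)); last first.
      by move=> k _; rewrite -scalerAr mulrA fac_mxEl scalerA.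
    rewrite -scaler_suml; congr (_ *: _).
    have E (M' : 'M[K]_n) : v *m M'^T = z *: v -> \sum_k v 0 k * M' j k = z * v 0 j.
      move=> /rowP/(_ j); rewrite !mxE => <-.
      by apply: eq_bigr => k _; rewrite mxE.
    exact: E vM.
  have aw : x * a * w = z *: w.
    rewrite -sum_gs mulr_sumr mulr_suml scaler_sumr; apply: eq_bigr => j _.
    by rewrite -!mulrA s_w -!scalerAr g_eps scalerA.
  have w0 : w = 0.
    by rewrite -(mul1r w) -yl -mulrA mulrBl aw -scalerAl mul1r subrr mulr0.
  move/eqP: v0; apply; apply/rowP => j; rewrite mxE.
  have /eqP := s_w j; rewrite w0 mulr0 eq_sym scaler_eq0 (negPf (eps_neq0 j)) orbF.
  by rewrite mulf_eq0 (negPf z0) => /eqP.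
have uM : z%:M - M \in unitmx by rewrite unitmxE unitfE.
pose N := invmx (z%:M - M).
have zN : z *: N - M *m N = 1%:M by rewrite -mul_scalar_mx -mulmxBl mulmxV.
have Nz : z *: N - N *m M = 1%:M by rewrite -mul_mx_scalar -mulmxBr mulVmx.
(* the identity [(z - b)^-1 = z^-1 * (1 + (z - b)^-1 * b)] suggests this
   inverse *)
exists (z^-1 *: (1 + border x N)); split.
  rewrite -scalerAr mulrDr mulr1 mulrBl border_mull -scalerAl mul1r.
  have -> : z *: border x N - border x (M *m N) = x * a.
    by rewrite -border1 -zN borderB.
  by rewrite subrK scalerA mulVf // scale1r.
rewrite -scalerAl mulrDl mul1r mulrBr border_mulr -scalerAr mulr1.
have -> : z *: border x N - border x (N *m M) = x * a.
  by rewrite -border1 -Nz borderB.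
by rewrite subrK scalerA mulVf // scale1r.
Qed.

Lemma fac_horner x (p : {poly K}) :
  horner_alg (x * a) p * (x * a) =
  border x (\sum_(i < size p) p`_i *: iter i (mulmx (fac_mx x)) 1%:M).
Proof.
rewrite -{1}[p]coefK poly_def rmorph_sum /= mulr_suml.
elim/big_ind2: _ => [|u N v N' uN vN'|i _].
- by rewrite border0.
- by rewrite -[N']scale1r border_lin scale1r uN vN'.
- rewrite linearZ rmorphXn /= horner_algX -!scalerAl mul1r.
  rewrite -[_ *: iter _ _ _]add0r border_lin border0 add0r.
  congr (_ *: _); rewrite -exprSr; elim: (nat_of_ord i) => [|k IH]; first by rewrite expr1 border1.
  by rewrite exprS IH border_mull.
Qed.

End FactorizationMatrix.

Lemma mx_char_poly_sum (K : fieldType) n (M : 'M[K]_n) :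
  \sum_(i < size (char_poly M)) (char_poly M)`_i *: iter i (mulmx M) 1%:M = 0.
Proof.
case: n M => [|n] M; first by apply/matrixP => -[].
rewrite -[RHS](Cayley_Hamilton M); move: (char_poly M) => p.
rewrite -[in RHS](coefK p) poly_def rmorph_sum /=.
apply: eq_bigr => i _; rewrite linearZ rmorphXn /= horner_mx_X; congr (_ *: _).
by elim: (nat_of_ord i) => [|k IH] //=; rewrite exprS IH.
Qed.

(** Cayley-Hamilton, up to the factor [x * a] that the factorization loses. *)
Lemma fac_char_poly (K : fieldType) (A : algType K) n (a : A)
    (g s eps : 'I_n -> A) x : factorization a g s eps ->
  horner_alg (x * a) (char_poly (fac_mx g s eps x)) * (x * a) = 0.
Proof. by move=> fac; rewrite (fac_horner fac) mx_char_poly_sum border0. Qed.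

(** * Minimal factorizations *)

(** Gram-Schmidt for a bilinear pairing between two spaces, where the hypothesis
    says that no nontrivial combination of the [v i] is orthogonal to all of
    [X]. *)
Lemma dual_system (K : fieldType) (X U : lmodType K) (b : X -> U -> K)
    (I : finType) (v : I -> U) (D : {set I}) :
    (forall x y c u, b (x + c *: y) u = b x u + c * b y u) ->
    (forall x u w c, b x (u + c *: w) = b x u + c * b x w) ->
    (forall c : I -> K, (forall x, b x (\sum_(i in D) c i *: v i) = 0) ->
      forall i, i \in D -> c i = 0) ->
  exists y : I -> X, forall i j, i \in D -> j \in D ->
    b (y i) (v j) = (i == j)%:R.
Proof.
move=> bl br.
have b0 x : b x 0 = 0.
  have := br x 0 0 (-1).
  by rewrite scaler0 addr0 mulN1r subrr.
have bsum x J (P : pred J) (r : seq J) (c : J -> K) (w : J -> U) :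
    b x (\sum_(i <- r | P i) c i *: w i) = \sum_(i <- r | P i) c i * b x (w i).
  elim: r => [|i r IH]; rewrite ?big_nil // !big_cons.
  by case: (P i) => //; rewrite addrC br IH addrC.
elim: {D}_.+1 {-2}D (ltnSn #|D|) => // m IH D; rewrite ltnS => Dm indep.
have [->|/finset.set0Pn[k kD]] := eqVneq D finset.set0.
  by exists (fun _ => 0) => i j; rewrite inE.
pose D' := D :\ k.
have [y Hy] : exists y : I -> X, forall i j, i \in D' -> j \in D' ->
    b (y i) (v j) = (i == j)%:R.
  apply: IH; first by rewrite (leq_trans _ Dm) // [X in (_ < X)%N](cardsD1 k) kD.
  move=> c c0 i iD'; have [ik iD] : i != k /\ i \in D.
    by apply/andP; rewrite -in_setD1.
  have := indep (fun i => if i == k then 0 else c i) _ i iD.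
  rewrite (negPf ik); apply=> x; rewrite -[RHS](c0 x) (big_setD1 k) //= eqxx.
  rewrite scale0r add0r; congr b; apply: eq_bigr => j.
  by rewrite !inE => /andP[/negPf-> _].
(* the component of [v k] outside the span of the other vectors *)
pose w := v k - \sum_(j in D') b (y j) (v k) *: v j.
have [x bxw] : exists x, b x w != 0.
  apply: contrapT => /forallNP bw.
  suff /eqP : (1 : K) = 0 by rewrite oner_eq0.
  have := indep (fun i => if i == k then 1 else - b (y i) (v k)) _ k kD.
  rewrite eqxx; apply=> x.
  have <- : b x w = 0 by apply/eqP; apply: contrapT => /negP; exact: bw.
  rewrite (big_setD1 k) //= eqxx scale1r; congr (b x (_ + _)).
  rewrite -sumrN; apply: eq_bigr => j.
  by rewrite !inE => /andP[/negPf-> _]; rewrite scaleNr.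
pose z := x - \sum_(j in D') b x (v j) *: y j.
have bzE u : b z u = b x u - \sum_(j in D') b x (v j) * b (y j) u.
  rewrite /z; elim: (index_enum I) {1 3}(x) => [|j r IHr] x'.
    by rewrite !big_nil !subr0.
  rewrite !big_cons; case: ifP => // _.
  by rewrite opprD addrA -scaleNr IHr bl mulNr opprD addrA.
have bz i : i \in D' -> b z (v i) = 0.
  move=> iD; rewrite bzE (bigD1 i) //= Hy // eqxx mulr1 big1 ?addr0 ?subrr //.
  by move=> j /andP[jD ji]; rewrite Hy // (negPf ji) mulr0.
have bzk : b z (v k) = b x w.
  rewrite bzE /w -scaleN1r br bsum mulN1r; congr (_ - _).
  by apply: eq_bigr => j _; rewrite mulrC.
pose yk := (b x w)^-1 *: z.
have byk u : b yk u = (b x w)^-1 * b z u.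
  have H : b 0 u = 0 by have := bl 0 0 (-1) u; rewrite scaler0 addr0 mulN1r subrr.
  by rewrite -[yk]add0r bl H add0r.
exists (fun i => if i == k then yk else y i - b (y i) (v k) *: yk).
move=> i j iD jD.
have D'P l : l \in D -> l != k -> l \in D' by move=> *; apply/finset.setD1P.
have bkj : b yk (v j) = (k == j)%:R.
  rewrite byk; have [<-|kj] := eqVneq k j; first by rewrite bzk mulVf.
  by rewrite bz ?mulr0 // D'P // eq_sym.
have [->//|ik] := eqVneq i k.
rewrite -scaleNr bl bkj mulNr; have [<-|kj] := eqVneq k j.
  by rewrite mulr1 subrr (negPf ik).
by rewrite mulr0 subr0 Hy ?D'P // eq_sym.
Qed.

Section MinimalFactorization.
Variables (K : fieldType) (A : algType K).
Hypothesis spA : semiprime A.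

Definition factorable (a : A) n :=
  exists g s eps : 'I_n -> A, factorization a g s eps.

(** A linear relation between the [g i] attached to one idempotent eliminates
    [g k]; the coefficients outside the class of [k] must vanish for the modified
    [s i] to stay in [eps i * A]. *)
Lemma factorable_drop_left a m (g s eps : 'I_m.+1 -> A) k (c : 'I_m.+1 -> K) :
    factorization a g s eps -> (forall i, c i != 0 -> eps i = eps k) ->
    c k != 0 -> \sum_i c i *: g i = 0 -> factorable a m.
Proof.
move=> [r1 disj ge es <-] ce ck sum0.
exists (g \o lift k), (fun i => s (lift k i) - (c k)^-1 * c (lift k i) *: s k),
  (eps \o lift k).
split=> /= [i|i j|i|i|]; [exact: r1|exact: disj|exact: ge| |].
  rewrite mulrBr -scalerAr es; have [->|c0] := eqVneq (c (lift k i)) 0.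
    by rewrite mulr0 !scale0r.
  by rewrite (ce _ c0) es.
have gk : g k = - \sum_i ((c k)^-1 * c (lift k i)) *: g (lift k i).
  move: sum0; rewrite (bigD1_ord k) //= => /eqP; rewrite addr_eq0 => /eqP E.
  rewrite -[LHS](scalerK ck) E scalerN scaler_sumr; congr (- _).
  by apply: eq_bigr => i _; rewrite scalerA.
rewrite (bigD1_ord k) //= {1}gk mulNr mulr_suml -sumrN -big_split /=.
by apply: eq_bigr => i _; rewrite mulrBr -scalerAr -scalerAl addrC.
Qed.

Lemma factorable_drop_right a m (g s eps : 'I_m.+1 -> A) k (c : 'I_m.+1 -> K) :
    factorization a g s eps -> (forall i, c i != 0 -> eps i = eps k) ->
    c k != 0 -> \sum_i c i *: s i = 0 -> factorable a m.
Proof.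
move=> [r1 disj ge es <-] ce ck sum0.
exists (fun i => g (lift k i) - (c k)^-1 * c (lift k i) *: g k), (s \o lift k),
  (eps \o lift k).
split=> /= [i|i j|i|i|]; [exact: r1|exact: disj| |exact: es|].
  rewrite mulrBl -scalerAl ge; have [->|c0] := eqVneq (c (lift k i)) 0.
    by rewrite mulr0 !scale0r.
  by rewrite (ce _ c0) ge.
have sk : s k = - \sum_i ((c k)^-1 * c (lift k i)) *: s (lift k i).
  move: sum0; rewrite (bigD1_ord k) //= => /eqP; rewrite addr_eq0 => /eqP E.
  rewrite -[LHS](scalerK ck) E scalerN scaler_sumr; congr (- _).
  by apply: eq_bigr => i _; rewrite scalerA.
rewrite (bigD1_ord k) //= {1}sk mulrN mulr_sumr -sumrN -big_split /=.
by apply: eq_bigr => i _; rewrite mulrBl -scalerAr -scalerAl addrC.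
Qed.

Lemma scalar_coef_lin (e : A) : rank1_idem e -> forall (x y : A) (c : K),
  scalar_coef e (e * (x + c *: y) * e) =
  scalar_coef e (e * x * e) + c * scalar_coef e (e * y * e).
Proof.
move=> [ee e0 eAe] x y c; have [b1 E1] := eAe x; have [b2 E2] := eAe y.
rewrite mulrDr mulrDl -scalerAr -scalerAl E1 E2 scalerA -scalerDl.
by rewrite !scalar_coefE.
Qed.

Lemma scalar_coefK (e u : A) :
  rank1_idem e -> e * u * e = scalar_coef e (e * u * e) *: e.
Proof. by move=> [ee e0 eAe]; have [c E] := eAe u; rewrite E scalar_coefE. Qed.

Section DualSystems.
Variables (a : A) (m : nat) (g s eps : 'I_m.+1 -> A).
Hypotheses (fac : factorization a g s eps) (mina : ~ factorable a m).

(** By semiprimeness, a combination of the [g i] attached to [eps k] that is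
    orthogonal to all of [eps k * A] is zero, and by minimality its coefficients
    vanish.  The other [g j] are killed by [eps k * A], since [eps j] and [eps k]
    are unlinked. *)
Lemma factorization_dual_left k :
  exists y, forall j, eps k * y * g j = (k == j)%:R *: eps k.
Proof.
have [r1 disj ge es _] := fac.
pose D := finset (fun i => eps i == eps k); have rk := r1 k.
have ek j : j \in D -> eps j = eps k by rewrite inE => /eqP.
have [||c c0 i iD|y Hy] := @dual_system K A A
  (fun y v => scalar_coef (eps k) (eps k * (y * v) * eps k)) _ g D.
- by move=> x y c u; rewrite mulrDl -scalerAl scalar_coef_lin.
- by move=> x u w c; rewrite mulrDr -scalerAr scalar_coef_lin.
- apply/eqP; apply: contraT => ci; exfalso; apply: mina.
  pose c' i := if i \in D then c i else 0.
  apply: (factorable_drop_left fac (k := i) (c := c')).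
  + by move=> j; rewrite /c'; case: ifP => [jD _|]; rewrite ?eqxx // (ek _ jD) (ek _ iD).
  + by rewrite /c' iD.
  set w := \sum_ i _.
  have wE : w = \sum_(i in D) c i *: g i.
    rewrite [RHS]big_mkcond; apply: eq_bigr => j _; rewrite /c'.
    by case: ifP; rewrite ?scale0r.
  have we : w * eps k = w.
    rewrite wE mulr_suml; apply: eq_bigr => j jD; rewrite -scalerAl.
    by rewrite -(ek _ jD) ge.
  apply/eqP; apply: contraT => /(semiprime_neq0 spA)[t].
  have := scalar_coefK (t * w) rk; rewrite {2}wE c0 scale0r => E.
  have -> : w * t * w = w * (eps k * (t * w) * eps k).
    by rewrite -{1}we -{2}we !mulrA.
  by rewrite E mulr0 eqxx.
- exists (y k) => j; have [jD|jD] := boolP (j \in D).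
    have kD : k \in D by rewrite inE.
    have := scalar_coefK (y k * g j) rk; rewrite Hy // => <-.
    by rewrite -!mulrA -(ek _ jD) ge.
  rewrite inE in jD; rewrite -(ge j) !mulrA -(mulrA (eps k)) disj 1?eq_sym //.
  have [kj|_] := eqVneq k j; last by rewrite scale0r.
  by rewrite kj eqxx in jD.
Qed.

Lemma factorization_dual_right k :
  exists z, forall j, s j * z * eps k = (k == j)%:R *: eps k.
Proof.
have [r1 disj ge es _] := fac.
pose D := finset (fun i => eps i == eps k); have rk := r1 k.
have ek j : j \in D -> eps j = eps k by rewrite inE => /eqP.
have [||c c0 i iD|z Hz] := @dual_system K A A
  (fun z v => scalar_coef (eps k) (eps k * (v * z) * eps k)) _ s D.
- by move=> x y c u; rewrite mulrDr -scalerAr scalar_coef_lin.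
- by move=> x u w c; rewrite mulrDl -scalerAl scalar_coef_lin.
- apply/eqP; apply: contraT => ci; exfalso; apply: mina.
  pose c' i := if i \in D then c i else 0.
  apply: (factorable_drop_right fac (k := i) (c := c')).
  + by move=> j; rewrite /c'; case: ifP => [jD _|]; rewrite ?eqxx // (ek _ jD) (ek _ iD).
  + by rewrite /c' iD.
  set w := \sum_ i _.
  have wE : w = \sum_(i in D) c i *: s i.
    rewrite [RHS]big_mkcond; apply: eq_bigr => j _; rewrite /c'.
    by case: ifP; rewrite ?scale0r.
  have we : eps k * w = w.
    rewrite wE mulr_sumr; apply: eq_bigr => j jD; rewrite -scalerAr.
    by rewrite -(ek _ jD) es.
  apply/eqP; apply: contraT => /(semiprime_neq0 spA)[t].
  have := scalar_coefK (w * t) rk; rewrite {2}wE c0 scale0r => E.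
  have -> : w * t * w = eps k * (w * t) * eps k * w.
    by rewrite -{1}we -{2}we !mulrA.
  by rewrite E mul0r eqxx.
- exists (z k) => j; have [jD|jD] := boolP (j \in D).
    have kD : k \in D by rewrite inE.
    have := scalar_coefK (s j * z k) rk; rewrite Hz // => <-.
    by rewrite !mulrA -(ek _ jD) es.
  rewrite inE in jD; rewrite -(es j) -!mulrA (mulrA (s j)) mulrA disj //.
  have [kj|_] := eqVneq k j; last by rewrite scale0r.
  by rewrite kj eqxx in jD.
Qed.

End DualSystems.

(** With dual systems [y] and [z] for the [g i] and the [s i], the matrix of
    [z k * eps k * y k] is the [k]-th diagonal unit. *)
Lemma minimal_factorization_diag a n (g s eps : 'I_n -> A) (d : 'I_n -> K) :
    factorization a g s eps -> (forall m, factorable a m -> (n <= m)%N) ->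
  exists x, fac_mx g s eps x = \matrix_(i, j) (d i *+ (i == j)).
Proof.
case: n g s eps d => [|n] g s eps d fac nmin.
  by exists 0; apply/matrixP => -[].
have mina : ~ factorable a n by move=> /nmin; rewrite ltnn.
have /choice [y Hy] := factorization_dual_left fac mina.
have /choice [z Hz] := factorization_dual_right fac mina.
have [r1 _ _ _ _] := fac.
exists (\sum_k d k *: (z k * eps k * y k)).
apply: (fac_mx_unique fac) => i j; rewrite mulr_sumr mulr_suml mxE.
rewrite (bigD1 i) //= big1 ?addr0 => [|k ki].
  rewrite -scalerAr -scalerAl !mulrA Hz eqxx scale1r Hy scalerA.
  by rewrite mulr_natr.
by rewrite -scalerAr -scalerAl !mulrA Hz (negPf ki) scale0r !mul0r scaler0.
Qed.

Lemma minimal_factorization_exists a n : factorable a n ->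
  exists m (g s eps : 'I_m -> A),
    factorization a g s eps /\ forall k, factorable a k -> (m <= k)%N.
Proof.
move=> fn; have ex : exists n, `[< factorable a n >] by exists n; apply/asboolP.
case: (ex_minnP ex) => m /asboolP[g [s [eps fac]]] mmin.
by exists m, g, s, eps; split => // k /asboolP; exact: mmin.
Qed.

End MinimalFactorization.

(** * Real-valued norms *)

Section RealNorm.
Variable R : realType.
Implicit Types V : normedZmodType R[i].

(** The norm of a normed module over [R[i]] takes its values in [R[i]]; its real
    version makes real arithmetic available. *)
Definition rnorm V (v : V) : R := complex.Re `|v|.

Lemma rnormE V (v : V) : `|v| = (rnorm v)%:C%C.
Proof. by rewrite /rnorm RRe_real // ger0_real. Qed.

Lemma rnorm_ge0 V (v : V) : 0 <= rnorm v.
Proof. by rewrite -ler0c -rnormE. Qed.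

Lemma rnorm_eq0 V (v : V) : (rnorm v == 0) = (v == 0).
Proof. by rewrite -(normr_eq0 v) rnormE (inj_eq (@complexI R) _ 0). Qed.

Lemma rnormD V (u v : V) : rnorm (u + v) <= rnorm u + rnorm v.
Proof. by rewrite -lecR rmorphD /= -!rnormE ler_normD. Qed.

Lemma rnormN V (v : V) : rnorm (- v) = rnorm v.
Proof. by rewrite /rnorm normrN. Qed.

Lemma rnormB V (u v : V) : rnorm (u - v) = rnorm (v - u).
Proof. by rewrite /rnorm distrC. Qed.

Lemma rnorm0 V : rnorm (0 : V) = 0.
Proof. by apply/eqP; rewrite rnorm_eq0. Qed.

Lemma rnorm_le V (v : V) (r : R) : (`|v| <= r%:C%C) = (rnorm v <= r).
Proof. by rewrite rnormE lecR. Qed.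

Lemma rnorm_lt V (v : V) (r : R) : (`|v| < r%:C%C) = (rnorm v < r).
Proof. by rewrite rnormE ltcR. Qed.

Lemma rnormM (z w : R[i]) : rnorm (z * w) = rnorm z * rnorm w.
Proof. by apply: complexI; rewrite rmorphM /= -!rnormE normrM. Qed.

Lemma rnormX (z : R[i]) n : rnorm (z ^+ n) = rnorm z ^+ n.
Proof. by apply: complexI; rewrite rmorphXn /= -!rnormE normrX. Qed.

Lemma rnormR (r : R) : rnorm r%:C%C = `|r|.
Proof. by rewrite /rnorm normc_def /= expr0n addr0 sqrtr_sqr. Qed.

Lemma rnorm1 : rnorm (1 : R[i]) = 1.
Proof. by rewrite /rnorm normr1. Qed.

Lemma rnormZ (A : normedModType R[i]) (z : R[i]) (v : A) :
  rnorm (z *: v) = rnorm z * rnorm v.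
Proof. by apply: complexI; rewrite rmorphM /= -!rnormE normrZ. Qed.

Lemma rnorm_mul (A : banachAlgebra R[i]) (x y : A) :
  rnorm (x * y) <= rnorm x * rnorm y.
Proof. by rewrite -lecR rmorphM /= -!rnormE ba_ler_normM. Qed.

Lemma rnorm_complex_le (s t : R) : rnorm (s +i* t)%C <= `|s| + `|t|.
Proof.
have -> : (s +i* t)%C = s%:C%C + 'i%C * t%:C%C by simpc.
apply: le_trans (rnormD _ _) _; rewrite rnormM !rnormR.
suff -> : rnorm ('i%C : R[i]) = 1 by rewrite mul1r.
by rewrite /rnorm normc_def /= expr0n add0r expr1n sqrtr1.
Qed.

Lemma complex_box (z : R[i]) : rnorm z <= 2 ->
  exists s t : R, [/\ s \in `[-2, 2], t \in `[-2, 2] & z = (s +i* t)%C].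
Proof.
case: z => s t zle; exists s, t.
have le (u : R) : u ^+ 2 <= s ^+ 2 + t ^+ 2 -> `|u| <= 2.
  move=> ule; apply: le_trans zle; rewrite /rnorm normc_def /=.
  by rewrite -sqrtr_sqr ler_sqrt // addr_ge0 // sqr_ge0.
rewrite !in_itv /= -!ler_norml !le ?lerDl ?lerDr ?sqr_ge0 //.
Qed.

End RealNorm.

(** * The Gelfand-Mazur theorem for corners *)

Section GelfandMazur.
Variables (R : realType) (A : banachAlgebra R[i]) (e : A).
Hypotheses (ee : e * e = e) (e0 : e != 0).
Implicit Types (u v w h : A) (z l : R[i]) (r s t : R).

Definition corner u := e * u * e = u.

Definition corner_inverse u h := [/\ corner h, h * u = e & u * h = e].

Lemma cornerl u : corner u -> e * u = u.
Proof. by move=> <-; rewrite !mulrA ee. Qed.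

Lemma cornerr u : corner u -> u * e = u.
Proof. by move=> <-; rewrite -!mulrA ee. Qed.

Lemma corner_inverse_uniq u h k :
  corner_inverse u h -> corner_inverse u k -> h = k.
Proof.
move=> [ch hu _] [ck _ uk].
by rewrite -(cornerr ch) -uk mulrA hu cornerl.
Qed.

Lemma rnorm_idem_ge1 : 1 <= rnorm e.
Proof.
have e_gt0 : 0 < rnorm e by rewrite lt0r rnorm_eq0 e0 rnorm_ge0.
have := rnorm_mul e e; rewrite ee => H.
by rewrite -(ler_pM2l e_gt0) mulr1.
Qed.

(** Averaging the two inverses at [l] and [- l] gives the inverse at [l ^+ 2]
    for the squared element; this replaces the contour integral of the
    resolvent by sums over the [2 ^ m]-th roots of unity. *)
Lemma corner_inverse_square w l h k :
  corner w -> corner_inverse (e - l *: w) h -> corner_inverse (e + l *: w) k ->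
  corner_inverse (e - l ^+ 2 *: (w * w)) (2^-1 *: (h + k)).
Proof.
move=> cw [ch hl lh] [ck kl lk].
set p := e - l *: w in hl lh *; set q := e + l *: w in kl lk *.
have pq : p * q = e - l ^+ 2 *: (w * w).
  rewrite mulrDr !mulrBl ee -!scalerAr -!scalerAl cornerr // cornerl //.
  by rewrite scalerA -expr2 addrA subrK.
have qp : q * p = e - l ^+ 2 *: (w * w).
  rewrite mulrDl !mulrBr ee -!scalerAr -!scalerAl cornerr // cornerl //.
  by rewrite scalerA -expr2 addrA subrK.
have sum_pq : p + q = 2 *: e by rewrite addrACA addNr addr0 scaler_nat.
have cp : corner p.
  by rewrite /corner mulrBr mulrBl ee ee -scalerAr -scalerAl cw.
have cq : corner q.
  by rewrite /corner mulrDr mulrDl ee ee -scalerAr -scalerAl cw.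
split.
- by rewrite /corner -scalerAr -scalerAl mulrDr mulrDl ch ck.
- rewrite -scalerAl mulrDl -{1}pq -qp !mulrA hl kl !cornerl // addrC sum_pq.
  by rewrite scalerA mulVf ?scale1r // pnatr_eq0.
- rewrite -scalerAr mulrDr -{1}qp -pq -!mulrA lh lk !cornerr // addrC sum_pq.
  by rewrite scalerA mulVf ?scale1r // pnatr_eq0.
Qed.

Section Resolvent.
Variables (w : A) (g : R[i] -> A).
Hypotheses (cw : corner w) (gP : forall l, corner_inverse (e - l *: w) (g l)).

Lemma resolvent_eq l z : g l - g z = (l - z) *: (g l * w * g z).
Proof.
have [cl gl _] := gP l; have [cz _ gz] := gP z.
have -> : g l - g z = g l * ((e - z *: w) - (e - l *: w)) * g z.
  by rewrite mulrBr mulrBl gl -mulrA gz cornerr // cornerl.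
rewrite opprB addrC addrA subrK -scalerBl -scalerAr -scalerAl.
done.
Qed.

Lemma resolvent_norm l z :
  rnorm (g l - g z) <= rnorm (l - z) * (rnorm (g l) * rnorm w * rnorm (g z)).
Proof.
rewrite resolvent_eq rnormZ ler_wpM2l ?rnorm_ge0 //.
apply: le_trans (rnorm_mul _ _) _; rewrite ler_wpM2r ?rnorm_ge0 //.
exact: rnorm_mul.
Qed.

(** The resolvent identity bounds [g l] by [g z] plus half of [g l] itself as soon
    as [l] is close to [z]. *)
Lemma resolvent_near z : exists2 d : R, 0 < d &
  forall l, rnorm (l - z) < d -> rnorm (g l) <= 2 * rnorm (g z).
Proof.
pose c := rnorm w * rnorm (g z); have c0 : 0 <= c by rewrite mulr_ge0 ?rnorm_ge0.
exists (2 * (c + 1))^-1; first by rewrite invr_gt0; lra.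
move=> l ld; have := resolvent_norm l z; have := rnormD (g l - g z) (g z).
rewrite subrK -(mulrA (rnorm (g l))) -/c.
have g0 : 0 <= rnorm (g l) by apply: rnorm_ge0.
have : rnorm (l - z) * (rnorm (g l) * c) <= 2^-1 * rnorm (g l).
  rewrite mulrCA mulrC ler_wpM2r //.
  have : rnorm (l - z) * (c + 1) <= 2^-1.
    by rewrite -ler_pdivlMr -?invfM ?ltW //; lra.
  have := rnorm_ge0 (l - z); nra.
lra.
Qed.

(** Compactness of the square [[-2, 2] x [-2, 2]], which contains the disk, makes
    the local bounds of [resolvent_near] uniform. *)
Lemma resolvent_bounded : exists2 C : R, 0 < C &
  forall l, rnorm l <= 2 -> rnorm (g l) <= C.
Proof.
pose K := (`[-2, 2]%classic `*` `[-2, 2]%classic : set (R * R)).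
have cK : compact K by apply: compact_setX; exact: segment_compact.
have := (iffLR (compact_near_coveringP K)) cK nat \oo
  (fun n p => rnorm (g (p.1 +i* p.2)%C) <= n%:R) _.
case=> [|N _ HN].
  move=> [s t] _; have [d d0 Hd] := resolvent_near (s +i* t)%C.
  near=> p n => /=.
  have pd : rnorm ((p.1 +i* p.2)%C - (s +i* t)%C) < d.
    have -> : (p.1 +i* p.2)%C - (s +i* t)%C = ((p.1 - s) +i* (p.2 - t))%C.
      by simpc.
    apply: le_lt_trans (rnorm_complex_le _ _) _.
    have p1d : `|s - p.1| < d / 2.
      by near: p; apply: cvgr_dist_lt; [exact: cvg_fst|rewrite divr_gt0].
    have p2d : `|t - p.2| < d / 2.
      by near: p; apply: cvgr_dist_lt; [exact: cvg_snd|rewrite divr_gt0].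
    rewrite distrC (distrC p.2); lra.
  apply: le_trans (Hd _ pd) _; near: n; exact: nbhs_infty_ger.
exists N.+1%:R; first by rewrite ltr0n.
move=> l /complex_box[s [t [sI tI ->]]].
by apply: (HN N.+1 _ (s, t)) => //=.
Unshelve. all: by end_near.
Qed.

Lemma corner_exp m : corner (w ^+ (2 ^ m)).
Proof.
elim: m => [|m IH]; first by rewrite expn0 expr1.
by rewrite expnS mul2n -addnn exprD /corner !mulrA cornerl // -mulrA cornerr.
Qed.

Lemma corner_inverse_exp m l :
  exists h, corner_inverse (e - l *: w ^+ (2 ^ m)) h.
Proof.
elim: m l => [|m IH] l; first by exists (g l); rewrite expn0 expr1.
have [h hP] := IH (sqrtC l); have [k kP] := IH (- sqrtC l).
exists (2^-1 *: (h + k)); rewrite expnS mul2n -addnn exprD -{1}(sqrtCK l).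
apply: corner_inverse_square => //; first exact: corner_exp.
by rewrite scaleNr opprK in kP.
Qed.

(** A modulus of continuity of the resolvent on circles passes from [w] to all
    its powers [w ^+ (2 ^ m)], unchanged. *)
Lemma corner_inverse_exp_dist r s (c : R) :
    (forall z, rnorm z = 1 -> rnorm (g (r%:C%C * z) - g (s%:C%C * z)) <= c) ->
  forall m z h k, rnorm z = 1 ->
    corner_inverse (e - ((r ^+ (2 ^ m))%:C%C * z) *: w ^+ (2 ^ m)) h ->
    corner_inverse (e - ((s ^+ (2 ^ m))%:C%C * z) *: w ^+ (2 ^ m)) k ->
  rnorm (h - k) <= c.
Proof.
move=> base; elim=> [|m IH] z h k z1.
  rewrite expn0 !expr1 => hP kP.
  rewrite (corner_inverse_uniq hP (gP _)) (corner_inverse_uniq kP (gP _)).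
  exact: base.
have y1 : rnorm (sqrtC z) = 1.
  have : rnorm (sqrtC z) ^+ 2 = 1 by rewrite -rnormX sqrtCK.
  move/eqP; rewrite sqrf_eq1 => /orP[/eqP //|/eqP E].
  by have := rnorm_ge0 (sqrtC z); rewrite E; lra.
set y := sqrtC z in y1.
have root_eq (u : R) : ((u ^+ (2 ^ m))%:C%C * y) ^+ 2 = (u ^+ (2 ^ m.+1))%:C%C * z.
  by rewrite exprMn sqrtCK -rmorphXn /= -exprM expnSr.
have split_inverse (u : R) h' :
    corner_inverse (e - ((u ^+ (2 ^ m.+1))%:C%C * z) *: w ^+ (2 ^ m.+1)) h' ->
    exists h1 h2, [/\ h' = 2^-1 *: (h1 + h2),
      corner_inverse (e - ((u ^+ (2 ^ m))%:C%C * y) *: w ^+ (2 ^ m)) h1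
    & corner_inverse (e - ((u ^+ (2 ^ m))%:C%C * - y) *: w ^+ (2 ^ m)) h2].
  move=> h'P; set l := (u ^+ (2 ^ m))%:C%C * y.
  have [h1 h1P] := corner_inverse_exp m l.
  have [h2 h2P] := corner_inverse_exp m (- l).
  exists h1, h2; rewrite mulrN; split=> //.
  apply: corner_inverse_uniq h'P _.
  rewrite -root_eq [in X in corner_inverse X _]expnS mul2n -addnn exprD.
  apply: corner_inverse_square => //; first exact: corner_exp.
  by rewrite scaleNr opprK in h2P.
move=> /split_inverse[h1 [h2 [-> h1P h2P]]] /split_inverse[k1 [k2 [-> k1P k2P]]].
have d1 := IH _ _ _ y1 h1P k1P.
have d2 : rnorm (h2 - k2) <= c by apply: IH h2P k2P; rewrite rnormN.
rewrite -scalerBr opprD addrACA rnormZ.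
have -> : rnorm (2^-1 : R[i]) = 2^-1.
  have -> : (2^-1 : R[i]) = (2^-1 : R)%:C%C by rewrite fmorphV rmorph_nat.
  by rewrite rnormR ger0_norm // invr_ge0 ler0n.
have := rnormD (h1 - k1) (h2 - k2); lra.
Qed.

Definition power_bounded r := exists M, forall m, (M <= m)%N ->
  rnorm ((r%:C%C *: w) ^+ (2 ^ m)) <= rnorm e.

Definition power_null r := forall c : R, 0 < c -> exists M, forall m, (M <= m)%N ->
  rnorm ((r%:C%C *: w) ^+ (2 ^ m)) <= c.

Lemma power_null_shrink r s :
  0 <= r -> r < s -> power_bounded s -> power_null r.
Proof.
move=> r0 rs [M HM] c c0; have s0 : 0 < s by exact: le_lt_trans rs.
pose q := r / s; have q0 : 0 <= q by rewrite divr_ge0 // ltW.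
have q1 : q < 1 by rewrite ltr_pdivrMr // mul1r.
have e_gt0 : 0 < rnorm e by apply: lt_le_trans rnorm_idem_ge1.
have /cvgr0_norm_lt/(_ (c / rnorm e)) : (q ^+ n @[n --> \oo] --> 0)%classic.
  by apply: cvg_expr; rewrite ger0_norm.
rewrite divr_gt0 // => /(_ isT)[N _ HN].
exists (maxn M N) => m; rewrite geq_max => /andP[Mm Nm].
have -> : r%:C%C *: w = q%:C%C *: (s%:C%C *: w).
  by rewrite scalerA -rmorphM /= divfK // gt_eqF.
rewrite exprZn rnormZ rnormX rnormR (ger0_norm q0).
have qm : q ^+ (2 ^ m) <= c / rnorm e.
  apply: le_trans (_ : q ^+ m <= _).
    by apply: (ler_wiXn2l q0 (ltW q1)); exact/ltnW/ltn_expl.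
  by apply/ltW; apply: le_lt_trans (HN m Nm); rewrite ler_norm.
have := HM m Mm; set x := rnorm _ => xe.
have e_neq0 : rnorm e != 0 by rewrite gt_eqF.
rewrite -[c](divfK e_neq0).
by apply: ler_pM => //; [exact: exprn_ge0 | exact: rnorm_ge0].
Qed.

(** If the powers of [r *: w] tend to [0], then the inverses of
    [e - (r *: w) ^+ (2 ^ m)] tend to [e].  The modulus of continuity does not
    depend on [m], so the inverses for [r + d] are within [1/2] of [e] for large
    [m], and this bounds the powers of [(r + d) *: w]. *)
Lemma power_null_step (C d r : R) :
    (forall l, rnorm l <= 2 -> rnorm (g l) <= C) -> 0 < C ->
    0 <= d -> d * (C * rnorm w * C) <= 4^-1 -> 0 <= r -> r + d <= 2 ->
  power_null r -> power_bounded (r + d).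
Proof.
move=> gC C0 d0 dC r0 rd2 nullr.
have e1 := rnorm_idem_ge1.
have [|M HM] := nullr (8 * rnorm e)^-1; first by rewrite invr_gt0; lra.
exists M => m /HM; set u := (_ *: w) ^+ _; set v := (_ *: w) ^+ _ => ule.
have uE : u = ((r ^+ (2 ^ m))%:C%C * 1) *: w ^+ (2 ^ m).
  by rewrite /u exprZn rmorphXn mulr1.
have vE : v = (((r + d) ^+ (2 ^ m))%:C%C * 1) *: w ^+ (2 ^ m).
  by rewrite /v exprZn rmorphXn mulr1.
have [h hP] := corner_inverse_exp m ((r ^+ (2 ^ m))%:C%C * 1).
have [k kP] := corner_inverse_exp m (((r + d) ^+ (2 ^ m))%:C%C * 1).
have hk : rnorm (h - k) <= 4^-1.
  apply: corner_inverse_exp_dist (rnorm1 R) hP kP => z z1.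
  have rz : rnorm (g (r%:C%C * z)) <= C.
    by apply: gC; rewrite rnormM z1 mulr1 rnormR ger0_norm //; lra.
  have rdz : rnorm (g ((r + d)%:C%C * z)) <= C.
    by apply: gC; rewrite rnormM z1 mulr1 rnormR ger0_norm //; lra.
  apply: le_trans (resolvent_norm _ _) _; apply: le_trans dC.
  rewrite -mulrBl rnormM z1 mulr1 -rmorphB /= rnormR opprD addNKr normrN.
  rewrite ger0_norm // ler_wpM2l // ler_pM ?mulr_ge0 ?rnorm_ge0 //.
  by rewrite ler_wpM2r ?rnorm_ge0.
have cu : corner u by rewrite uE /corner -scalerAr -scalerAl corner_exp.
have cv : corner v by rewrite vE /corner -scalerAr -scalerAl corner_exp.
rewrite -uE in hP; rewrite -vE in kP.
have [ch _ uh] := hP; have [ck _ vk] := kP.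
have hE : h - e = u * h.
  by rewrite -uh mulrBl cornerl // opprB addrC subrK.
have kE : v = (k - e) * (e - v).
  have [_ kv _] := kP.
  by rewrite mulrBl kv mulrBr ee cornerl // opprB addrC subrK.
have h2 : rnorm (u * h) <= (8 * rnorm e)^-1 * rnorm h.
  by apply: le_trans (rnorm_mul _ _) _; rewrite ler_wpM2r ?rnorm_ge0.
have hle : rnorm h <= rnorm (u * h) + rnorm e.
  by rewrite -hE -{1}(subrK e h) rnormD.
have he : rnorm (h - e) <= 4^-1.
  rewrite hE; apply: (le_trans h2).
  have h0 := rnorm_ge0 h.
  have E8 : (8 * rnorm e)^-1 <= 8^-1.
    by rewrite lef_pV2 ?posrE //; lra.
  have E8' : (8 * rnorm e)^-1 * (8 * rnorm e) = 1 by rewrite mulVf //; lra.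
  have E80 : 0 <= (8 * rnorm e)^-1 by rewrite invr_ge0; lra.
  have : (8 * rnorm e)^-1 * rnorm h <= 8^-1 * rnorm h by apply: ler_wpM2r.
  move: (rnorm e) (rnorm h) (rnorm (u * h)) (8 * rnorm e)^-1 h2 hle h0 e1 E8 E8' E80.
  move=> e' h' uh' t h2 hle h0 e1 E8 E8' E80 H.
  have h2e : h' <= 2 * e' by lra.
  have : t * h' <= t * (2 * e') by rewrite ler_wpM2l.
  lra.
have ke : rnorm (k - e) <= 2^-1.
  have -> : k - e = (k - h) + (h - e) by rewrite addrA subrK.
  apply: le_trans (rnormD _ _) _; rewrite (rnormB k); lra.
have := rnorm_mul (k - e) (e - v); rewrite -kE => vle.
have := rnormD e (- v); rewrite rnormN => ev.
have ev0 := rnorm_ge0 (e - v); have := rnorm_ge0 v; nra.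
Qed.

(** The steps have a fixed length [d / 2], so they reach the radius [1] from [0];
    the bound on the resolvent is taken on the disk of radius [2] to leave room for
    the last step. *)
Lemma power_null1 : power_null 1.
Proof.
have [C C0 gC] := resolvent_bounded.
pose B := C * rnorm w * C; have B0 : 0 <= B by rewrite !mulr_ge0 ?rnorm_ge0 // ltW.
have [K HK] : exists K : nat, 4 * B + 1 <= K%:R.
  by exists (Num.truncn (4 * B + 1)).+1; rewrite ltW // truncnS_gt.
have K0 : 0 < K%:R :> R by lra.
pose d : R := K%:R^-1; have d0 : 0 < d by rewrite invr_gt0.
have dK : d * K%:R = 1 by rewrite mulVf // gt_eqF.
have dB : d * B <= 4^-1 by nra.
have d1 : d <= 1 by nra.
have chain j : (j <= 2 * K)%N -> power_null (j%:R * (d / 2)).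
  elim: j => [_ c c0|j IH jK].
    by exists 0%N => m _; rewrite mul0r scale0r expr0n expn_eq0 /= rnorm0 ltW.
  have jd : 0 <= j%:R * (d / 2) by rewrite mulr_ge0 ?ler0n //; lra.
  have jle : j.+1%:R * (d / 2) <= 1.
    have : (j.+1%:R : R) <= (2 * K)%:R by rewrite ler_nat.
    rewrite natrM; nra.
  have jS : j.+1%:R * (d / 2) = j%:R * (d / 2) + d / 2 by rewrite -natr1 mulrDl mul1r.
  apply: (@power_null_shrink _ (j%:R * (d / 2) + d)); [lra|lra|].
  by apply: (power_null_step gC) => //; [exact: ltW|lra|exact/IH/ltnW].
have := chain _ (leqnn _).
by rewrite natrM mulrC mulrA divfK ?pnatr_eq0 // dK.
Qed.

End Resolvent.

(** If a corner division algebra held a non-scalar [w], then [w] and its inverse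
    would both have powers tending to [0]. *)
Theorem gelfand_mazur_corner :
    (forall x, e * x * e != 0 -> exists2 z, e * z * e = z & z * (e * x * e) = e) ->
  rank1_idem e.
Proof.
move=> div; split=> // x; set w := e * x * e.
have cw : corner w by rewrite /corner /w !mulrA ee -mulrA ee.
apply: contrapT => /forallNP wNe.
have corner_div u : corner u -> u != 0 -> exists2 h, corner h & h * u = e /\ u * h = e.
  move=> cu u0; have [|h ch hu] := div u; first by rewrite -/(corner u) cu.
  rewrite cu in hu; exists h => //; split => //.
  have h0 : h != 0.
    by apply/eqP => h0; move: e0; rewrite -hu h0 mul0r eqxx.
  have [|k ck kh] := div h; first by rewrite ch.
  rewrite ch in kh; suff -> : u = k by [].
  by rewrite -(cornerl cu) -kh -mulrA hu cornerr.
have null v : corner v -> (forall c, v <> c *: e) ->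
    forall c : R, 0 < c -> exists M, forall m, (M <= m)%N -> rnorm (v ^+ (2 ^ m)) <= c.
  move=> cv vNe.
  have /choice [g gP] l : exists h, corner_inverse (e - l *: v) h.
    have cl : corner (e - l *: v).
      by rewrite /corner mulrBr mulrBl ee ee -scalerAr -scalerAl cv.
    have [|h ch [hl lh]] := corner_div _ cl; last by exists h.
    apply/eqP => /eqP; rewrite subr_eq0 => /eqP E.
    have [l0|l0] := eqVneq l 0; first by move: e0; rewrite E l0 scale0r eqxx.
    by apply: (vNe l^-1); rewrite E scalerA mulVf // scale1r.
  by have := power_null1 cv gP; rewrite /power_null scale1r.
have w0 : w != 0 by apply/eqP => w0; apply: (wNe 0); rewrite scale0r.
have [v cv [vw wv]] := corner_div _ cw w0.
have vNe c : v <> c *: e.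
  move=> vE; have c0 : c != 0.
    by apply/eqP => c0; move: e0; rewrite -vw vE c0 scale0r mul0r eqxx.
  apply: (wNe c^-1); rewrite -vw vE -scalerAl cornerl // scalerA mulVf //.
  by rewrite scale1r.
have powM k : v ^+ k.+1 * w ^+ k.+1 = e.
  elim: k => [|k IH]; first by rewrite !expr1.
  have eW : e * w ^+ k.+1 = w ^+ k.+1 by rewrite exprS mulrA cornerl.
  by rewrite exprSr (exprS w) mulrA -(mulrA _ v w) vw -mulrA eW.
have [M1 H1] := null w cw wNe 2^-1 (ltac:(lra)).
have [M2 H2] := null v cv vNe 2^-1 (ltac:(lra)).
have := H1 _ (leq_maxl M1 M2); have := H2 _ (leq_maxr M1 M2).
set k := (2 ^ maxn M1 M2)%N => hv hw.
have k0 : (0 < k)%N by rewrite expn_gt0.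
have := rnorm_mul (v ^+ k) (w ^+ k); rewrite -(prednK k0) powM (prednK k0).
have := rnorm_idem_ge1; have := rnorm_ge0 (v ^+ k); have := rnorm_ge0 (w ^+ k).
nra.
Qed.

End GelfandMazur.

(** * Continuity of the roots of a polynomial *)

Section RootContinuity.
Variable R : realType.
Notation C := R[i].

Lemma finite_pos_lower_bound (I : finType) (f : I -> R) :
  exists2 c : R, 0 < c & forall i, 0 < f i -> c <= f i.
Proof.
exists (\big[Num.min/1]_(i | 0 < f i) f i).
  by apply: lt_bigmin => //; exact: ltr01.
by move=> i fi; apply: bigmin_le_cond.
Qed.

Lemma rnorm_sum (V : normedZmodType C) I (r : seq I) (P : pred I) (f : I -> V) :
  rnorm (\sum_(i <- r | P i) f i) <= \sum_(i <- r | P i) rnorm (f i).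
Proof.
elim/big_rec2: _ => [|i x y _ H]; first by rewrite rnorm0.
by apply: le_trans (rnormD _ _) _; rewrite lerD2l.
Qed.

Lemma rnorm_prod I (r : seq I) (P : pred I) (f : I -> C) :
  rnorm (\prod_(i <- r | P i) f i) = \prod_(i <- r | P i) rnorm (f i).
Proof.
elim/big_rec2: _ => [|i x y _ <-]; first by rewrite rnorm1.
by rewrite rnormM.
Qed.

Lemma rnorm_prodB n (f h : 'I_n -> C) (B c : R) :
    1 <= B -> 0 <= c -> (forall i, rnorm (f i) <= B) ->
    (forall i, rnorm (h i) <= B) -> (forall i, rnorm (f i - h i) <= c) ->
  rnorm (\prod_i f i - \prod_i h i) <= n%:R * (B ^+ n * c).
Proof.
move=> B1 c0; have B0 : 0 <= B by apply: le_trans B1.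
elim: n f h => [|n IH] f h fB hB fh.
  by rewrite !big_ord0 subrr rnorm0 mul0r.
rewrite !big_ord_recl.
set F := \prod_(i < n) _; set H := \prod_(i < n) _.
have -> : f ord0 * F - h ord0 * H = (f ord0 - h ord0) * F + h ord0 * (F - H).
  by rewrite mulrBl mulrBr addrA subrK.
apply: le_trans (rnormD _ _) _; rewrite !rnormM -natr1 addrC mulrDl mul1r.
have FB : rnorm F <= B ^+ n.
  rewrite rnorm_prod -[n in B ^+ n]card_ord -prodr_const.
  by apply: ler_prod => i _; rewrite rnorm_ge0 fB.
apply: lerD.
  have IH' := IH (fun i => f (lift ord0 i)) (fun i => h (lift ord0 i))
    (fun i => fB _) (fun i => hB _) (fun i => fh _).
  rewrite exprS -mulrA mulrCA; apply: ler_pM => //; exact: rnorm_ge0.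
have -> : B ^+ n.+1 * c = c * B ^+ n * B by rewrite exprSr mulrC mulrA.
have H1 : rnorm (f ord0 - h ord0) * rnorm F <= c * B ^+ n.
  by apply: ler_pM; rewrite ?rnorm_ge0.
apply: le_trans H1 _; rewrite ler_peMr // mulr_ge0 // exprn_ge0 //.
Qed.

Definition root_prod n (v : 'I_n -> C) : {poly C} := \prod_i ('X - (v i)%:P).

Lemma size_root_prod n (v : 'I_n -> C) : size (root_prod v) = n.+1.
Proof. by rewrite /root_prod -big_enum size_prod_XsubC size_enum_ord. Qed.

Lemma root_prod_splits n (p : {poly C}) : p \is monic -> size p = n.+1 ->
  exists v : 'I_n -> C, p = root_prod v.
Proof.
move=> pm ps; have [r E] := closed_field_poly_normal p.
rewrite (monicP pm) scale1r in E.
have sr : size r = n by move: ps; rewrite E size_prod_XsubC => -[].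
by exists (fun i => r`_i); rewrite E (big_nth 0) big_mkord sr.
Qed.

Lemma horner_root_prod n (v : 'I_n -> C) z :
  (root_prod v).[z] = \prod_i (z - v i).
Proof. by rewrite horner_prod; apply: eq_bigr => i _; rewrite hornerXsubC. Qed.

Lemma root_root_prod n (v : 'I_n -> C) z :
  root (root_prod v) z = [exists i, v i == z].
Proof.
rewrite /root horner_root_prod; apply/prodf_eq0/existsP => -[j].
  by move=> _; rewrite subr_eq0 eq_sym => vj; exists j.
by move=> vj; exists j; rewrite // subr_eq0 eq_sym.
Qed.

Lemma horner_coefs_le (p : {poly C}) (d : R) m z :
    (size p <= m)%N -> (forall j, rnorm p`_j <= d) ->
  rnorm p.[z] <= m%:R * (d * (1 + rnorm z) ^+ m).
Proof.
move=> pm pd; rewrite (horner_coef_wide _ pm).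
apply: le_trans (rnorm_sum _ _ _) _.
rewrite mulr_natl -[m in _ *+ m]card_ord -sumr_const.
apply: ler_sum => j _; rewrite rnormM rnormX.
have z0 := rnorm_ge0 z.
apply: ler_pM; rewrite ?rnorm_ge0 ?exprn_ge0 //.
apply: le_trans (_ : (1 + rnorm z) ^+ j <= _).
  by apply: lerXn2r; rewrite ?nnegrE ?addr_ge0 ?lerDr.
by apply: ler_weXn2l; [rewrite lerDl | exact/ltnW].
Qed.

Lemma size_root_prodB n (mu nu : 'I_n -> C) :
  (size (root_prod mu - root_prod nu)%R <= n)%N.
Proof.
apply/leq_sizeP => j; rewrite leq_eqVlt => /orP[/eqP <-|nj]; rewrite coefB.
  have lead (v : 'I_n -> C) : (root_prod v)`_n = 1.
    have /monicP : root_prod v \is monic by apply: monic_prod_XsubC.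
    by rewrite /lead_coef size_root_prod.
  by rewrite !lead subrr.
by rewrite !nth_default ?size_root_prod // subrr.
Qed.

Lemma poly_eq_on_nat n (p q : {poly C}) :
    (size p <= n)%N -> (size q <= n)%N ->
    (forall j : 'I_n, p.[j%:R] = q.[j%:R]) -> p = q.
Proof.
move=> pn qn pq; apply/eqP; rewrite -subr_eq0; apply: contraT => pq0.
pose r : seq C := [seq j%:R | j <- iota 0 n].
have ur : uniq r.
  by rewrite map_inj_uniq ?iota_uniq // => i j /eqP; rewrite eqr_nat => /eqP.
have rr : all (root (p - q)) r.
  apply/allP => x /mapP[j]; rewrite mem_iota => /= jn ->.
  by rewrite rootE hornerD hornerN (pq (Ordinal jn)) subrr.
have := max_poly_roots pq0 rr ur; rewrite size_map size_iota ltnNge.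
by rewrite (leq_trans (size_polyD _ _)) // geq_max size_polyN pn.
Qed.

(** Each root of a nearby polynomial is near some root [nu (k i)].  Moving it
    there yields one of the finitely many products [root_prod (nu \o k)], and a
    product of this kind that is close enough to [root_prod nu] is equal to it. *)
Lemma roots_continuous n (nu : 'I_n -> C) (c : R) : 0 < c ->
  exists2 d : R, 0 < d & forall mu : 'I_n -> C,
    (forall j, rnorm ((root_prod mu)`_j - (root_prod nu)`_j) <= d) ->
  exists2 k : 'I_n -> 'I_n, forall i, rnorm (mu i - nu (k i)) < c &
    root_prod (nu \o k) = root_prod nu.
Proof.
move=> c0.
pose B : R := 1 + \sum_i rnorm (nu i).
have B1 : 1 <= B by rewrite lerDl sumr_ge0 // => i _; exact: rnorm_ge0.
have nuB i : rnorm (nu i) <= B.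
  rewrite /B (bigD1 i) //= addrCA lerDl addr_ge0 // sumr_ge0 // => l _.
  exact: rnorm_ge0.
(* the smallest positive distance, measured at [0, ..., n], from [root_prod nu]
   to another product built on the same roots *)
have [gap gap0 gapP] := finite_pos_lower_bound
  (fun kw : {ffun 'I_n -> 'I_n} * 'I_n.+1 =>
    rnorm ((root_prod (nu \o kw.1)).[(kw.2 : nat)%:R] - (root_prod nu).[(kw.2 : nat)%:R])).
pose B' : R := n%:R + B + 1.
have n0 : 0 <= n%:R :> R by rewrite ler0n.
have B'1 : 1 <= B' by rewrite /B'; lra.
(* [c'] makes the displacement of the roots cost at most a third of [gap] *)
pose L : R := n%:R * B' ^+ n + 1.
have L1 : 1 <= L by rewrite lerDr mulr_ge0 // exprn_ge0 //; lra.
pose c' := Num.min (Num.min c 1) (gap / (3 * L)).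
have c'0 : 0 < c' by rewrite !lt_min c0 ltr01 divr_gt0 //; lra.
have c'c : c' <= c by rewrite !ge_min lexx.
have c'1 : c' <= 1 by rewrite !ge_min lexx orbT.
have c'L : c' * L <= gap / 3.
  have L0 : 0 < L by lra.
  rewrite -ler_pdivlMr // -mulrA -invfM.
  by rewrite !ge_min lexx !orbT.
(* if [mu i] is far from all roots then [1 + rnorm (mu i)] is at most [D] times
   each distance, whatever the size of [mu i] *)
pose D : R := 1 + (B + 1) / c'.
have D1 : 1 <= D by rewrite lerDl divr_ge0 ?ltW //; lra.
(* amplification of an error on the coefficients by evaluation, relative to the
   distances at a root far from [nu] for [S1], and at [0, ..., n] for [S2] *)
pose S1 : R := n%:R * D ^+ n + 1.
pose S2 : R := n%:R * (1 + n%:R) ^+ n + 1.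
have S11 : 1 <= S1 by rewrite lerDr mulr_ge0 // exprn_ge0 //; lra.
have S21 : 1 <= S2 by rewrite lerDr mulr_ge0 // exprn_ge0 //; lra.
pose d := Num.min (2 * S1)^-1 (gap / (3 * S2)).
have d0 : 0 < d by rewrite lt_min invr_gt0 divr_gt0 //; lra.
have dS1 : d * S1 < 1.
  have : d * (2 * S1) <= 1.
    by rewrite -ler_pdivlMr ?mul1r ?ge_min ?lexx //; lra.
  nra.
have dS2 : d * S2 <= gap / 3.
  have S20 : 0 < S2 by lra.
  by rewrite -ler_pdivlMr // -mulrA -invfM !ge_min lexx orbT.
exists d => // mu close.
have closeB j : rnorm (root_prod mu - root_prod nu)`_j <= d by rewrite coefB.
have near i : exists k, rnorm (mu i - nu k) < c'.
  apply: contrapT => /forallNP far.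
  set t := rnorm (mu i); have t0 : 0 <= t by exact: rnorm_ge0.
  have big k : 1 + t <= D * rnorm (mu i - nu k).
    have far_k : c' <= rnorm (mu i - nu k) by rewrite leNgt; apply/negP/far.
    have : t <= rnorm (mu i - nu k) + B.
      have := rnormD (mu i - nu k) (nu k); rewrite subrK -/t => tle.
      by apply: le_trans tle _; rewrite lerD2l.
    have : B + 1 <= (B + 1) / c' * rnorm (mu i - nu k).
      by rewrite mulrAC ler_pdivlMr // ler_wpM2l //; lra.
    rewrite /D mulrDl mul1r; lra.
  have := horner_coefs_le (mu i) (size_root_prodB mu nu) closeB.
  rewrite hornerD hornerN; have -> : (root_prod mu).[mu i] = 0.
    by apply/rootP; rewrite root_root_prod; apply/existsP; exists i.
  rewrite sub0r rnormN horner_root_prod rnorm_prod -/t => small.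
  have bigprod : (1 + t) ^+ n <= D ^+ n * \prod_k rnorm (mu i - nu k).
    rewrite -[n in _ ^+ n]card_ord -[n in D ^+ n]card_ord -!prodr_const -big_split.
    by apply: ler_prod => k _; rewrite big andbT; lra.
  have pos : 0 < (1 + t) ^+ n by apply: exprn_gt0; lra.
  have D0 : 0 <= D ^+ n by apply: exprn_ge0; lra.
  have : (1 + t) ^+ n <= d * (n%:R * D ^+ n) * (1 + t) ^+ n.
    apply: (le_trans bigprod); apply: le_trans (ler_wpM2l D0 small) _.
    by rewrite [leRHS](_ : _ = D ^+ n * (n%:R * (d * (1 + t) ^+ n))) //; ring.
  rewrite leNgt => /negP; apply; rewrite -[ltRHS]mul1r ltr_pM2r //.
  apply: le_lt_trans dS1; rewrite ler_wpM2l ?lerDl //; exact: ltW.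
have /choice[k Hk] := near.
exists k => [i|]; first exact: lt_le_trans (Hk i) c'c.
apply: (@poly_eq_on_nat n.+1); rewrite ?size_root_prod //.
move=> j; apply/eqP; rewrite -subr_eq0 -rnorm_eq0; apply: contraT => ne0.
have := gapP ([ffun i => k i], j).
have E : root_prod (nu \o [ffun i => k i]) = root_prod (nu \o k).
  by apply: eq_bigr => i _; rewrite /= ffunE.
rewrite /= E lt0r ne0 rnorm_ge0 => /(_ isT).
have jn : (j : nat)%:R <= n%:R :> R by rewrite ler_nat -ltnS.
have rj : rnorm ((j : nat)%:R : C) = j%:R.
  have -> : ((j : nat)%:R : C) = ((j : nat)%:R : R)%:C%C by rewrite rmorph_nat.
  by rewrite rnormR ger0_norm // ler0n.
have H1 : rnorm ((root_prod (nu \o k)).[j%:R] - (root_prod mu).[j%:R]) <= gap / 3.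
  rewrite !horner_root_prod; apply: le_trans (rnorm_prodB B'1 (ltW c'0) _ _ _) _.
  - move=> i /=; apply: le_trans (rnormD _ _) _; rewrite rnormN rj /B'.
    by have := nuB (k i); lra.
  - move=> i /=; apply: le_trans (rnormD _ _) _; rewrite rnormN rj /B'.
    have := rnormD (mu i - nu (k i)) (nu (k i)); rewrite subrK.
    by have := nuB (k i); have := Hk i; lra.
  - move=> i /=; rewrite (_ : _ - _ - _ = mu i - nu (k i)); last by ring.
    exact/ltW/Hk.
  - rewrite (_ : _ * _ = c' * (n%:R * B' ^+ n)); last by ring.
    by apply: le_trans c'L; rewrite ler_wpM2l ?lerDl // ltW.
have H2 : rnorm ((root_prod mu).[j%:R] - (root_prod nu).[j%:R]) <= gap / 3.
  rewrite -hornerN -hornerD.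
  apply: le_trans (horner_coefs_le _ (size_root_prodB mu nu) closeB) _.
  rewrite rj; apply: le_trans dS2.
  have j0 : 0 <= (j : nat)%:R :> R by rewrite ler0n.
  rewrite mulrCA ler_wpM2l //; first exact: ltW.
  apply: le_trans (_ : n%:R * (1 + n%:R) ^+ n <= _); last by rewrite lerDl.
  by rewrite ler_wpM2l // lerXn2r // ?nnegrE ?lerD2l //; lra.
have := rnormD ((root_prod (nu \o k)).[j%:R] - (root_prod mu).[j%:R])
  ((root_prod mu).[j%:R] - (root_prod nu).[j%:R]).
rewrite addrA subrK; lra.
Qed.

End RootContinuity.

(** * Characteristic polynomials along a path of matrices *)

Section CharPolyContinuity.
Variables (C : numFieldType) (T : topologicalType) (x0 : T).

Definition coef_continuous (p : T -> {poly C}) :=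
  forall k, {for x0, continuous (fun x => (p x)`_k)}.

Lemma coef_continuous_sum I (r : seq I) (p : I -> T -> {poly C}) :
  (forall i, coef_continuous (p i)) ->
  coef_continuous (fun x => \sum_(i <- r) p i x).
Proof.
move=> pc k; rewrite (_ : (fun x => _) = fun x => \sum_(i <- r) (p i x)`_k); last first.
  by apply/funext => x; rewrite coef_sum.
elim: r => [|i r IH].
  rewrite (_ : (fun x => _) = fun=> 0); first exact: cst_continuous.
  by apply/funext => x; rewrite big_nil.
rewrite (_ : (fun x => _) = (fun x => (p i x)`_k) \+ (fun x => \sum_(i <- r) (p i x)`_k)).
  by apply: continuousD => //; exact: pc.
by apply/funext => x; rewrite big_cons.
Qed.

Lemma coef_continuousM (p q : T -> {poly C}) :
  coef_continuous p -> coef_continuous q -> coef_continuous (fun x => p x * q x).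
Proof.
move=> pc qc k.
rewrite (_ : (fun x => _) = fun x => \sum_(i < k.+1) (p x)`_i * (q x)`_(k - i)); last first.
  by apply/funext => x; rewrite coefM.
elim: (index_enum _) => [|i r IH].
  rewrite (_ : (fun x => _) = fun=> 0); first exact: cst_continuous.
  by apply/funext => x; rewrite big_nil.
rewrite (_ : (fun x => _) = (fun x => (p x)`_i * (q x)`_(k - i)) \+
    (fun x => \sum_(i <- r) (p x)`_i * (q x)`_(k - i))).
  apply: continuousD => //; apply: continuousM; [exact: pc | exact: qc].
by apply/funext => x; rewrite big_cons.
Qed.

Lemma coef_continuous_cst (p : {poly C}) : coef_continuous (fun=> p).
Proof. by move=> k; exact: cst_continuous. Qed.

Lemma coef_continuous_prod I (r : seq I) (p : I -> T -> {poly C}) :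
  (forall i, coef_continuous (p i)) ->
  coef_continuous (fun x => \prod_(i <- r) p i x).
Proof.
move=> pc; elim: r => [|i r IH].
  rewrite (_ : (fun x => _) = fun=> 1); first exact: coef_continuous_cst.
  by apply/funext => x; rewrite big_nil.
rewrite (_ : (fun x => _) = fun x => p i x * \prod_(i <- r) p i x).
  exact: coef_continuousM.
by apply/funext => x; rewrite big_cons.
Qed.

Lemma char_poly_coef_continuous n (M : T -> 'M[C]_n) :
  (forall i j, {for x0, continuous (fun x => M x i j)}) ->
  coef_continuous (fun x => char_poly (M x)).
Proof.
move=> Mc; rewrite /char_poly /determinant.
apply: coef_continuous_sum => s; apply: coef_continuousM.
  exact: coef_continuous_cst.
apply: coef_continuous_prod => i k.
rewrite (_ : (fun x => _) = fun x => ('X *+ (i == s i))`_k + - (M x i (s i) *+ (k == 0%N))).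
  apply: (@continuousD _ _ _ (fun=> _) (fun x => - (M x i (s i) *+ _))).
    exact: cst_continuous.
  apply: continuousN; case: (k == 0%N).
    exact: Mc.
  exact: cst_continuous.
by apply/funext => x; rewrite !mxE coefB coefC; case: (k == 0%N).
Qed.

Lemma char_poly_coef_near n (M : T -> 'M[C]_n) :
    (forall i j (c : C), 0 < c -> \forall x \near x0, `|M x0 i j - M x i j| <= c) ->
  forall k (c : C), 0 < c ->
    \forall x \near x0, `|(char_poly (M x0))`_k - (char_poly (M x))`_k| <= c.
Proof.
move=> Mc k c c0; have := @char_poly_coef_continuous n M _ k.
move=> /(_ _)/cvgrPdist_le; apply => // i j.
by apply/cvgrPdist_le => e e0; exact: Mc.
Qed.

End CharPolyContinuity.

Lemma small_nonroot (R : realType) (p : {poly R[i]}) (d : R) : p != 0 -> 0 < d ->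
  exists2 t : R[i], rnorm t < d & ~~ root p t.
Proof.
move=> p0 d0; apply: contrapT => /forall2NP H.
pose f (k : nat) : R[i] := (d / k.+2%:R)%:C%C.
have ur : uniq (map f (iota 0 (size p))).
  rewrite map_inj_uniq ?iota_uniq // => i j /complexI /(mulfI (lt0r_neq0 d0)).
  by move=> /invr_inj/eqP; rewrite eqr_nat => /eqP[].
have rr : all (root p) (map f (iota 0 (size p))).
  apply/allP => x /mapP[j _ ->]; have [|/negP] := H (f j); last by rewrite negbK.
  case; rewrite rnormR ger0_norm; last by rewrite divr_ge0 // ltW.
  by rewrite ltr_pdivrMr // ltr_pMr // ltr1n.
by have := max_poly_roots p0 rr ur; rewrite size_map size_iota ltnn.
Qed.

(** The resultant of ['X * char_poly (M + t *: N)] and its derivative is a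
    polynomial in [t], so the matrices with distinct nonzero eigenvalues are
    dense on every line that contains one of them. *)
Lemma separable_char_poly_dense (R : realType) n (M N : 'M[R[i]]_n) (d : R) :
    0 < d -> separable_poly ('X * char_poly (M + N)) ->
  exists2 t : R[i], rnorm t < d & separable_poly ('X * char_poly (M + t *: N)).
Proof.
move=> d0 sep1.
pose P : {poly {poly R[i]}} :=
  'X * char_poly (map_mx polyC M + 'X *: map_mx polyC N).
have evP t : map_poly (horner_eval t) P = 'X * char_poly (M + t *: N).
  rewrite rmorphM /= map_polyX map_char_poly; congr ('X * char_poly _).
  by apply/matrixP => i j; rewrite !mxE /= /horner_eval !hornerE.
have Pm : P \is monic by rewrite monicMl ?monicX ?char_poly_monic.
have sP : size P = n.+2.
  by rewrite size_monicM ?monicX ?monic_neq0 ?char_poly_monic // size_polyX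
    size_char_poly.
have coefP' : P^`()`_n = n.+1%:R.
  have := monicP Pm; rewrite /lead_coef sP coef_deriv => ->.
  by [].
have n1 : n.+1%:R != 0 :> {poly R[i]}.
  by rewrite -polyC_natr polyC_eq0 pnatr_eq0.
have sP' : size P^`() = n.+1.
  apply/anti_leq; rewrite -ltnS -sP lt_size_deriv ?monic_neq0 //=.
  rewrite ltnNge; apply/negP => /leq_sizeP H.
  by move: n1; rewrite -coefP' H ?eqxx.
have evr t : (resultant P P^`()).[t] =
    resultant ('X * char_poly (M + t *: N)) ('X * char_poly (M + t *: N))^`().
  rewrite -evP deriv_map -map_resultant //.
    by rewrite (monicP Pm) rmorph1 oner_eq0.
  rewrite /lead_coef sP' coefP' rmorph_nat pnatr_eq0 //.
have res_sep (p : {poly R[i]}) : p != 0 ->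
    (resultant p p^`() != 0) = separable_poly p.
  move=> p0; rewrite resultant_eq0 separable_poly.unlock /coprimep.
  have g0 : (0 < size (gcdp p p^`()))%N.
    by rewrite size_poly_gt0 gcdp_eq0 negb_and p0.
  by rewrite -leqNgt eqn_leq g0 andbT.
have nz (t : R[i]) : 'X * char_poly (M + t *: N) != 0.
  by rewrite mulf_neq0 ?polyX_eq0 // monic_neq0 // char_poly_monic.
have r0 : resultant P P^`() != 0.
  apply/eqP => r0; have := evr 1; rewrite r0 horner0 => /esym/eqP.
  by apply/negP; rewrite res_sep ?nz // scale1r.
have [t td rt] := small_nonroot r0 d0; exists t => //.
by rewrite -res_sep // -evr.
Qed.

(** * Counting spectral points *)

Section CountingPoints.
Variable R : realType.
Implicit Types (K L : set R[i]) (l : seq R[i]).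

Lemma nb_points_seq K l : uniq l -> K = [set` l] -> nb_points K = (size l)%:R%:E.
Proof.
move=> ul ->; rewrite /nb_points /counting asboolT; last exact: finite_seq.
congr (_%:R%:E); rewrite -{2}(undup_id ul) -card_fseq; congr (#|` _|).
apply/fsetP => z; rewrite in_fset_set; last exact: finite_seq.
by rewrite in_fset; apply/idP/idP; rewrite inE.
Qed.

Lemma nb_points_le K L (k m : nat) : K `<=` L ->
  nb_points K = k%:R%:E -> nb_points L = m%:R%:E -> (k <= m)%N.
Proof.
rewrite /nb_points /counting => KL.
case: asboolP => // fK [] /eqP; rewrite eqr_nat => /eqP <-.
case: asboolP => // fL [] /eqP; rewrite eqr_nat => /eqP <-.
by apply: fsubset_leq_card; rewrite -fset_set_sub.
Qed.

End CountingPoints.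

(** Divide [p] by ['X] as long as its constant term vanishes, which the left
    inverse allows; then the constant term provides a right inverse. *)
Lemma left_invertible_algebraic (K : fieldType) (A : algType K) (a b : A)
    (p : {poly K}) :
  b * a = 1 -> p != 0 -> horner_alg a p = 0 -> invertible a.
Proof.
move=> ba; elim/poly_ind: p => [|p c IH]; first by rewrite eqxx.
rewrite rmorphD rmorphM /= horner_algX horner_algC => pc0.
have comm : horner_alg a p * a = a * horner_alg a p.
  by rewrite -{2 3}(horner_algX a) -!rmorphM /= mulrC.
rewrite comm; have [cE|c0] := eqVneq c 0.
  rewrite cE scale0r addr0 => ap0; apply: IH.
    by apply: contraNneq pc0 => ->; rewrite mul0r add0r cE.
  by rewrite -[LHS]mul1r -ba -mulrA ap0 mulr0.
move=> /eqP; rewrite addr_eq0 => /eqP apc.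
have ar : a * (- c^-1 *: horner_alg a p) = 1.
  by rewrite -scalerAr apc scalerN scaleNr opprK scalerA mulVf // scale1r.
exists b; split => //; suff -> : b = - c^-1 *: horner_alg a p by [].
by rewrite -[LHS]mulr1 -ar mulrA ba mul1r.
Qed.

Section MinimalFactorizationSpectrum.
Variables (R : realType) (A : banachAlgebra R[i]) (a : A) (n : nat).
Variables (g s eps : 'I_n -> A).
Hypotheses (spA : semiprime A) (fac : factorization a g s eps).
Hypothesis nmin : forall m, factorable a m -> (n <= m)%N.
Notation C := R[i].
Implicit Types (x : A) (mu nu : 'I_n -> C).

Let M x : 'M[C]_n := fac_mx g s eps x.

Lemma fac_mx_near j k (c : C) : 0 < c ->
  \forall x \near (1 : A), `|M 1 j k - M x j k| <= c.
Proof.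
move=> c0; have e0 : 0 < `|eps j| by case: fac => /(_ j)[_ H _ _ _ _]; rewrite normr_gt0.
pose B := `|s j| * `|g k| / `|eps j|.
have B0 : 0 <= B by rewrite divr_ge0 ?mulr_ge0.
have d0 : 0 < c / (B + 1) by rewrite divr_gt0 // ltr_wpDl.
near=> x.
have xd : `|1 - x| <= c / (B + 1).
  by near: x; apply: cvgr_dist_le => //; exact: cvg_id.
have E : (M 1 j k - M x j k) *: eps j = s j * (1 - x) * g k.
  by rewrite scalerBl -!(fac_mxEl fac) -mulrBl -mulrBr.
have : `|M 1 j k - M x j k| * `|eps j| <= `|s j| * `|1 - x| * `|g k|.
  rewrite -normrZ E; apply: le_trans (ba_ler_normM _ _) _.
  by rewrite ler_wpM2r // ba_ler_normM.
rewrite -ler_pdivlMr // => /le_trans; apply.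
have -> : `|s j| * `|1 - x| * `|g k| / `|eps j| = `|1 - x| * B.
  by rewrite /B (mulrC `|s j|) -!mulrA.
apply: le_trans (_ : c / (B + 1) * B <= _); first by rewrite ler_wpM2r.
rewrite mulrAC ler_pdivrMr ?ltr_wpDl // ler_wpM2l // ?lerDl //; exact: ltW.
Unshelve. all: by end_near.
Qed.

Lemma fac_spectrumP x z : z != 0 ->
  spectrum (x * a) z <-> root (char_poly (M x)) z.
Proof.
move=> z0; have inv := fac_spectrum fac x z0; split.
  by move=> ninv; apply: contrapT => /negP /inv.
by move=> rz /inv; rewrite rz.
Qed.

Lemma char_poly_roots x : exists mu, char_poly (M x) = root_prod mu.
Proof. by apply: root_prod_splits; rewrite ?char_poly_monic ?size_char_poly. Qed.

Lemma mem_codom_root mu z : (z \in codom mu) = root (root_prod mu) z.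
Proof.
rewrite root_root_prod; apply/codomP/existsP => -[j].
  by move=> ->; exists j.
by move=> /eqP <-; exists j.
Qed.

Lemma nb_nz_spectrum x mu : char_poly (M x) = root_prod mu ->
  nb_points (nz_spectrum (x * a)) =
  (size (undup [seq z <- codom mu | z != 0]))%:R%:E.
Proof.
move=> E; apply: nb_points_seq; first exact: undup_uniq.
apply/seteqP; split=> z /=; rewrite mem_undup mem_filter mem_codom_root -E.
  by move=> [/fac_spectrumP rz /eqP z0]; rewrite z0 rz.
by move=> /andP[z0 rz]; split; [apply/fac_spectrumP | exact/eqP].
Qed.

Lemma size_undup_nz mu : (size (undup [seq z <- codom mu | z != 0%R]) <= n)%N.
Proof.
apply: leq_trans (size_undup _) _; rewrite size_filter.
by have := count_size (fun z => z != 0) (codom mu); rewrite size_codom card_ord.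
Qed.

Lemma size_undup_nzE mu :
  (size (undup [seq z <- codom mu | z != 0]) == n) = uniq (0 :: codom mu).
Proof.
have sc : size (codom mu) = n by rewrite size_codom card_ord.
apply/idP/idP => [/eqP E | /= /andP[z0 u]].
  have : (size (undup [seq z <- codom mu | z != 0%R]) <=
      size [seq z <- codom mu | z != 0%R])%N.
    exact: size_undup.
  rewrite E size_filter => nc.
  have /all_filterP F : all (fun z => z != 0) (codom mu).
    by rewrite all_count eqn_leq count_size sc.
  rewrite F in E; rewrite /= -(negbK (uniq _)) -ltn_size_undup E sc ltnn andbT.
  by rewrite -F mem_filter eqxx.
have /all_filterP -> : all (fun z => z != 0) (codom mu).
  by apply/allP => z zc; apply: contraNneq z0 => <-.
by rewrite undup_id // sc.
Qed.

Lemma separable_codom mu :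
  separable_poly ('X * root_prod mu) = uniq (0 :: codom mu).
Proof.
rewrite -separable_prod_XsubC big_cons polyC0 subr0; congr (separable_poly (_ * _)).
by rewrite /codom /image_mem big_map big_enum.
Qed.

Lemma fac_mx_separable_exists :
  exists x, separable_poly ('X * char_poly (M x)).
Proof.
have [x xE] := minimal_factorization_diag spA (fun j : 'I_n => j.+1%:R) fac nmin.
exists x; rewrite /M xE char_poly_trig; last first.
  apply/is_trig_mxP => i j ij; rewrite mxE; case: eqP => [E|//].
  by rewrite E ltnn in ij.
have -> : \prod_(i < n) ('X - ((\matrix_(i, j) (i.+1%:R *+ (i == j))) i i)%:P) =
    root_prod (fun j : 'I_n => j.+1%:R) :> {poly C}.
  by apply: eq_bigr => i _; rewrite mxE eqxx.
rewrite separable_codom /=; apply/andP; split.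
  by apply/codomP => -[j /eqP]; rewrite eq_sym pnatr_eq0.
apply/injectiveP => i j /eqP; rewrite eqr_nat => /eqP[]; exact: val_inj.
Qed.

(** The matrix has size [n], and by minimality it takes diagonal values with [n]
    distinct nonzero entries. *)
Lemma rank_minimal_factorization : rank a = n%:R%:E.
Proof.
apply/eqP; rewrite eq_le; apply/andP; split.
  apply: ge_ereal_sup => _ [x _ <-]; have [mu E] := char_poly_roots x.
  by rewrite (nb_nz_spectrum E) lee_fin ler_nat size_undup_nz.
have [x sx] := fac_mx_separable_exists; have [mu E] := char_poly_roots x.
apply: ereal_sup_ubound; exists x => //; rewrite (nb_nz_spectrum E).
by move: sx; rewrite E separable_codom -size_undup_nzE => /eqP ->.
Qed.

Lemma rank_attainingP x mu : char_poly (M x) = root_prod mu ->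
  rank_attaining a x <-> uniq (0 :: codom mu).
Proof.
move=> E; rewrite -size_undup_nzE /rank_attaining /=.
rewrite rank_minimal_factorization (nb_nz_spectrum E); split=> [[/eqP]|/eqP -> //].
by rewrite eqr_nat.
Qed.

Lemma rank_attaining_dense (P : A -> Prop) : (\forall x \near (1 : A), P x) ->
  exists x, rank_attaining a x /\ P x.
Proof.
move=> /nbhs_ballP[d /= d0 dP]; have [x0 sx0] := fac_mx_separable_exists.
pose v := x0 - 1; pose B := rnorm v + 1.
have B0 : 0 < B by rewrite ltr_wpDl ?rnorm_ge0.
have dR : d = (complex.Re d)%:C%C by rewrite RRe_real // gtr0_real.
have d'0 : 0 < complex.Re d by rewrite -ltcR -dR.
have sep : separable_poly ('X * char_poly (M 1 + M v)).
  have := fac_mx_lin fac 1 v 1; rewrite !scale1r -!/(M _) => <-.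
  by rewrite /v addrC subrK.
have [t td st] := separable_char_poly_dense (divr_gt0 d'0 B0) sep.
exists (1 + t *: v); have [mu E] := char_poly_roots (1 + t *: v); split.
  rewrite (rank_attainingP E) -separable_codom -E.
  by rewrite /M (fac_mx_lin fac).
apply: dP; rewrite -ball_normE /= opprD addNKr normrN dR rnorm_lt rnormZ.
rewrite ltr_pdivlMr // in td; apply: le_lt_trans td.
by rewrite ler_wpM2l ?rnorm_ge0 // lerDl.
Qed.

Lemma fac_roots_near nu (c : R) : 0 < c -> char_poly (M 1) = root_prod nu ->
  \forall x \near (1 : A), forall mu, char_poly (M x) = root_prod mu ->
  exists2 k : 'I_n -> 'I_n, forall i, rnorm (mu i - nu (k i)) < c &
    root_prod (nu \o k) = root_prod nu.
Proof.
move=> c0 E1; have [d d0 H] := roots_continuous nu c0.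
have dC : 0 < d%:C%C :> C by rewrite ltcR.
have coefs : \forall x \near (1 : A), forall j : 'I_n.+1,
    `|(char_poly (M 1))`_j - (char_poly (M x))`_j| <= d%:C%C.
  apply: filter_forall => j; apply: char_poly_coef_near => // i k e e0.
  exact: fac_mx_near.
apply: filterS coefs => x coefs mu Ex; apply: H => j; rewrite rnormB -E1 -Ex -rnorm_le.
have [jn|jn] := ltnP j n.+1; last first.
  by rewrite !nth_default ?size_char_poly // subrr normr0 ltW.
exact: (coefs (Ordinal jn)).
Qed.

Lemma fac_left_invertible x : invertible (x * a) -> invertible a.
Proof.
move=> [y [_ yxa]]; have nz : char_poly (M 1) * 'X != 0.
  by rewrite mulf_neq0 ?polyX_eq0 // monic_neq0 // char_poly_monic.
apply: (@left_invertible_algebraic _ _ a (y * x) _ _ nz); first by rewrite -mulrA.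
have := fac_char_poly 1 fac; rewrite mul1r => ch.
by rewrite rmorphM /= horner_algX.
Qed.

Lemma spectrum0 x : spectrum x (0 : C) <-> ~ invertible x.
Proof.
have inv_opp (y : A) : invertible y -> invertible (- y).
  by move=> [z [yz zy]]; exists (- z); rewrite !mulrNN.
rewrite /spectrum /= scale0r sub0r; split=> H /inv_opp; last by rewrite opprK.
exact: H.
Qed.

Lemma spectrum_mull0 x : spectrum a (0 : C) -> spectrum (x * a) (0 : C).
Proof. by move=> /spectrum0 na; apply/spectrum0 => /fac_left_invertible. Qed.

(** These are the candidates for the points of the spectrum of [a]; the matrix
    determines the spectrum only away from [0]. *)
Let pt nu (p : option 'I_n) : C := oapp nu 0 p.

Lemma fac_spectrum_pt nu z : char_poly (M 1) = root_prod nu ->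
  spectrum a z -> exists p, z = pt nu p.
Proof.
move=> E1 az; have [->|z0] := eqVneq z 0; first by exists None.
have /(fac_spectrumP 1 z0) : spectrum (1 * a) z by rewrite mul1r.
by rewrite E1 root_root_prod => /existsP[i /eqP <-]; exists (Some i).
Qed.

Lemma root_separation nu : exists2 r0 : R, 0 < r0 &
  forall p q, pt nu p != pt nu q -> 2 * r0 <= rnorm (pt nu p - pt nu q).
Proof.
have [r0 r00 H] := finite_pos_lower_bound
  (fun pq : option 'I_n * option 'I_n => rnorm (pt nu pq.1 - pt nu pq.2) / 2).
exists r0 => // p q pq; have := H (p, q); rewrite /= divr_gt0 //; last first.
  by rewrite lt0r rnorm_ge0 rnorm_eq0 subr_eq0 pq.
by move=> /(_ isT); lra.
Qed.

(** The multiplicity of [z] as a root of ['X * root_prod nu]. *)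
Definition root_mult nu z : nat := (z == 0) + #|[pred j | nu j == z]|.

Lemma root_prod_card nu nu' z : root_prod nu = root_prod nu' ->
  #|[pred j | nu j == z]| = #|[pred j | nu' j == z]|.
Proof.
have cardE (v : 'I_n -> C) : #|[pred j | v j == z]| = mup z (root_prod v).
  have -> : root_prod v = \prod_(w <- codom v) ('X - w%:P).
    by rewrite /codom /image_mem big_map big_enum.
  by rewrite mu_prod_XsubC /codom /image_mem count_map -size_filter cardE enumT.
by move=> E; rewrite !cardE E.
Qed.

(** For [x] near [1] attaining the rank, the eigenvalues of [fac_mx x] are
    distinct and nonzero, so counting points counts roots with multiplicity; and
    [0] is in the spectrum of [x * a] as soon as it is in that of [a]. *)
Lemma spectrum_count_near nu (r r0 : R) : char_poly (M 1) = root_prod nu ->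
    (forall p q, pt nu p != pt nu q -> 2 * r0 <= rnorm (pt nu p - pt nu q)) ->
    0 < r -> r <= r0 ->
  \forall x \near (1 : A), rank_attaining a x -> forall z, spectrum a z ->
    nb_points (spectrum (x * a) `&` open_disk z r%:C%C) = (root_mult nu z)%:R%:E.
Proof.
move=> E1 sep r_gt0 rr0; near=> x; move=> Ex z az.
have [mu Emu] := char_poly_roots x.
have : exists2 k : 'I_n -> 'I_n, forall i, rnorm (mu i - nu (k i)) < r &
    root_prod (nu \o k) = root_prod nu.
  by move: mu Emu; near: x; exact: fac_roots_near.
move=> [k close Ek]; have [p zp] := fac_spectrum_pt E1 az.
have /andP[mu0 umu] : uniq (0 :: codom mu) by apply/(rank_attainingP Emu).
have mu_neq0 i : mu i != 0.
  by apply: contraNneq mu0 => <-; exact: codom_f.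
pose l := nseq (z == 0) 0 ++ [seq mu i | i in [pred j | nu (k j) == z]].
have sl : size l = root_mult nu z.
  rewrite size_cat size_nseq size_image; congr (_ + _)%N.
  exact: (root_prod_card z Ek).
rewrite -sl; apply: nb_points_seq.
  rewrite cat_uniq map_inj_uniq ?enum_uniq; last exact/injectiveP.
  rewrite andbT; apply/andP; split; first by case: eqP.
  apply/hasPn => w /mapP[i _ ->]; rewrite mem_nseq negb_and mu_neq0 orbT //.
apply/seteqP; split=> w /=; rewrite mem_cat mem_nseq /open_disk /= rnorm_lt.
  move=> [xw wz]; have [w0|w0] := eqVneq w 0.
    rewrite w0 in wz *; rewrite andbT lt0b; apply/orP; left.
    apply: contraT => z0; have := sep None p; rewrite -zp eq_sym z0 => /(_ isT).
    by move: wz; rewrite sub0r rnormN; lra.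
  move: xw => /(fac_spectrumP x w0); rewrite Emu root_root_prod.
  move=> /existsP[i /eqP wi]; apply/orP; right; rewrite -wi map_f // mem_enum inE.
  apply: contraT => nz; have := sep (Some (k i)) p; rewrite -zp /= => /(_ nz).
  have := close i; have := rnormD (nu (k i) - mu i) (mu i - z).
  by rewrite addrA subrK (rnormB _ (mu i)) wi; lra.
move=> /orP[/andP[z0 /eqP ->]|/fintype.imageP[j]].
  move: z0; rewrite lt0b => /eqP z0; rewrite z0 in az *; split.
    exact: spectrum_mull0.
  by rewrite subrr rnorm0.
rewrite inE => /eqP kj ->; split; last by rewrite -kj.
by apply/fac_spectrumP => //; rewrite Emu root_root_prod; apply/existsP; exists j.
Unshelve. all: by end_near.
Qed.

(** The radius and the neighbourhood in the definition of the multiplicity are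
    arbitrary, but a rank-attaining [x] close enough to [1] serves both them and
    a smaller disk, on which [spectrum_count_near] gives the count. *)
Lemma multiplicity_ge nu z : char_poly (M 1) = root_prod nu -> spectrum a z ->
  (root_mult nu z <= multiplicity a z)%N.
Proof.
move=> E1 az; have [r0 r0_gt0 sep] := root_separation nu.
have ex : is_multiplicity a z (root_mult nu z).
  exists r0%:C%C; first split; first by rewrite ltcR.
    apply/seteqP; split=> w /=; last by move=> ->; rewrite /open_disk /= subrr normr0 ltcR.
    move=> [aw]; rewrite /open_disk /= rnorm_lt => wz.
    have [p zp] := fac_spectrum_pt E1 az; have [q wq] := fac_spectrum_pt E1 aw.
    apply/eqP; apply: contraT => nwz; have := sep q p; rewrite -zp -wq => /(_ nwz).
    by lra.
  have /nbhs_ballP[d /= d0 H] := spectrum_count_near E1 sep r0_gt0 (lexx _).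
  by exists d => // x Ex xd; exact: H.
rewrite /multiplicity; case: xgetP => [k _|/(_ (root_mult nu z))[]//] /=.
move=> [r [r_gt0 _] [d d0 Hk]].
have rR : r = (complex.Re r)%:C%C by rewrite RRe_real // gtr0_real.
have r'0 : 0 < complex.Re r by rewrite -ltcR -rR.
pose t := Num.min (complex.Re r) r0.
have t0 : 0 < t by rewrite lt_min r'0.
have tr0 : t <= r0 by rewrite ge_min lexx orbT.
have [x [Ex [Hx xd]]] := rank_attaining_dense
  (filterI (spectrum_count_near E1 sep t0 tr0) (nbhsx_ballx (1 : A) d d0)).
apply: (nb_points_le _ (Hx Ex z az) (Hk x Ex xd)).
move=> w [xw wz]; split => //; apply: lt_le_trans wz _.
by rewrite [leRHS]rR lecR ge_min lexx.
Qed.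

(** When [0] is not in the spectrum, [a] is invertible and the factor ['X] and the
    zero roots are cancelled, so that all the remaining roots are spectral. *)
Lemma fac_char_poly_eq0 nu : char_poly (M 1) = root_prod nu ->
  exists l, [/\ forall z, z \in l -> spectrum a z,
    forall z, (count_mem z l <= root_mult nu z)%N
  & horner_alg a (\prod_(z <- l) ('X - z%:P)) = 0].
Proof.
move=> E1; pose l := 0 :: codom nu.
have lE : \prod_(z <- l) ('X - z%:P) = 'X * root_prod nu.
  rewrite big_cons polyC0 subr0; congr (_ * _).
  by rewrite /codom /image_mem big_map big_enum.
have countE z : count_mem z l = root_mult nu z.
  rewrite /= eq_sym /root_mult; congr (_ + _)%N.
  by rewrite /codom /image_mem count_map -size_filter cardE enumT.
have l0 : horner_alg a (\prod_(z <- l) ('X - z%:P)) = 0.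
  have := fac_char_poly 1 fac; rewrite mul1r -/(M 1) E1 lE => ch.
  by rewrite mulrC rmorphM /= horner_algX.
have lspec z : z \in l -> z != 0 -> spectrum a z.
  rewrite inE => /orP[/eqP -> /eqP //|]; rewrite mem_codom_root -E1 => rz z0.
  by have /fac_spectrumP : root (char_poly (M 1)) z by []; rewrite mul1r; exact.
have [a0|na0] := pselect (spectrum a (0 : C)).
  exists l; split=> // z; last by rewrite countE.
  by have [->//|z0 zl] := eqVneq z 0; exact: lspec.
have [b [ab ba]] : invertible a by apply: contrapT => /spectrum0.
exists [seq z <- l | z != 0]; split=> [z|z|].
- by rewrite mem_filter => /andP[z0 zl]; exact: lspec.
- by rewrite -countE; exact/leq_count_subseq/filter_subseq.
move: l0; rewrite (bigID (fun z => z == 0)) /= -[X in _ * X]big_filter rmorphM /=.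
suff cancel (q : A) :
    horner_alg a (\prod_(z <- l | z == 0) ('X - z%:P)) * q = 0 -> q = 0.
  exact: cancel.
clear lE countE lspec; clearbody l; elim: l => [|z l IH]; first by rewrite big_nil rmorph1 mul1r.
rewrite big_cons; case: eqP => // ->; rewrite polyC0 subr0 rmorphM /= horner_algX.
by move=> aPq; apply: IH; rewrite -[LHS]mul1r -ba -mulrA [a * _]mulrA aPq mulr0.
Qed.

End MinimalFactorizationSpectrum.

(** * The generalized Cayley-Hamilton theorem *)

Lemma prod_XsubC_uniq (F : fieldType) (S l : seq F) :
    uniq S -> {subset l <= S} ->
  \prod_(z <- l) ('X - z%:P) = \prod_(z <- S) ('X - z%:P) ^+ count_mem z l.
Proof.
move=> uS; elim: l => [|z l IH] lS.
  by rewrite big_nil big1_seq // => z _; rewrite expr0.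
have zS : z \in S by apply: lS; exact: mem_head.
rewrite big_cons IH; last by move=> w wl; apply: lS; rewrite inE wl orbT.
rewrite [RHS](eq_bigr (fun w => ('X - w%:P) ^+ (z == w) * ('X - w%:P) ^+ count_mem w l)).
  rewrite big_split; congr (_ * _); rewrite (bigD1_seq z) //= eqxx expr1.
  rewrite big1 ?mulr1 // => w wz.
  by rewrite eq_sym (negPf wz) expr0.
by move=> w _; rewrite -exprD.
Qed.

Lemma prod_XsubC_dvd (F : fieldType) (S l : seq F) (m : F -> nat) :
    uniq S -> {subset l <= S} -> (forall z, z \in S -> count_mem z l <= m z)%N ->
  exists q, \prod_(z <- S) (z%:P - 'X) ^+ m z = q * \prod_(z <- l) ('X - z%:P).
Proof.
move=> uS lS lm; rewrite (prod_XsubC_uniq uS lS).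
exists (\prod_(z <- S) ((-1) ^+ count_mem z l * (z%:P - 'X) ^+ (m z - count_mem z l))).
rewrite -big_split; apply: eq_big_seq => z zS /=.
rewrite -mulrA (mulrC (_ ^+ (m z - _))) mulrA -exprMn mulN1r opprB -exprD.
by rewrite subnKC // lm.
Qed.

Lemma socle_factorable (R : realType) (A : banachAlgebra R[i]) (a : A) :
  semiprime A -> socle A a -> exists n, factorable a n.
Proof.
move=> spA [n [f [fL ->]]].
have /choice[e He] i : exists e, rank1_idem e /\ f i * e = f i.
  have [L Lmin Lf] := fL i.
  have [e [ee e0 Le div]] := minimal_left_ideal_idempotent spA Lmin.
  by exists e; split; [exact: gelfand_mazur_corner | exact: Le].
exists n; apply: (factorization_sum spA (e := e)) => i; by have [] := He i.
Qed.

Theorem theorem2p6 (R : realType) (A : banachAlgebra R[i])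
    (hA : semisimple A) (a : A) (ha : socle A a) :
  horner_alg a (gen_char_poly a) = 0 /\
  \prod_(z <- fset_set (spectrum a)) (z%:A - a) ^+ multiplicity a z = 0.
Proof.
have spA := semisimple_semiprime hA.
have [n0 fa] := socle_factorable spA ha.
have [n [g [s [eps [fac nmin]]]]] := minimal_factorization_exists fa.
have [nu E1] := char_poly_roots g s eps 1.
have finS : finite_set (spectrum a).
  apply: (@sub_finite_set _ _ [set` 0 :: codom nu]); last exact: finite_seq.
  move=> z /(fac_spectrum_pt fac E1)[[j|] ->] /=; last by rewrite inE eqxx.
  by rewrite inE codom_f orbT.
have [l [lspec lcount l0]] := fac_char_poly_eq0 fac E1.
have p0 : horner_alg a (gen_char_poly a) = 0.
  have [|z zl|z zS|q E] := @prod_XsubC_dvd _ (fset_set (spectrum a)) l (multiplicity a).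
  - exact: fset_uniq.
  - by rewrite in_fset_set // inE; exact: lspec.
  - apply: leq_trans (lcount z) _; apply: (multiplicity_ge spA fac nmin E1).
    by move: zS; rewrite in_fset_set // inE.
  - by rewrite /gen_char_poly E rmorphM /= l0 mulr0.
split => //; rewrite -[RHS]p0 /gen_char_poly rmorph_prod.
apply: eq_bigr => z _; rewrite rmorphXn rmorphB /= horner_algX horner_algC //.
Qed.
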